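(* Consider a stochastic shortest path problem (undiscounted) with state set $S=\{1,\dots,n\}$ in which all policies are proper. At each iteration $t$ one state is selected at random, state $i$ being selected with probability $p(i)>0$, and $$J_{t+1}(i)=\begin{cases}(1-\gamma_t(i))J_t(i)+\gamma_t(i)\left(J^{\mu_t}(i)+w_t(i)\right), & \text{if state } i \text{ is selected (probability } p(i)),\\ J_t(i), & \text{otherwise,}\end{cases}$$ where $\mu_t$ satisfies $T_{\mu_t}J_t=TJ_t$. For each of the following two choices of stepsizes, $J_t$ converges to $J^*$ with probability 1: (a) $\gamma_t(i)=\dfrac{1}{n_i(t)}$, where $n_i(t)$ is the number of times state $i$ is selected up to (and including) iteration $t$; (b) $\gamma_t(i)=\dfrac{\hat\gamma_t}{p(i)}$, where $\hat\gamma_t$ satisfies $\sum_{t=0}^\infty\hat\gamma_t=\infty$ and $\sum_{t=0}^\infty\hat\gamma_t^2<\infty$.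
   Context: Stochastic shortest path problem: $S=\{1,\dots,n\}$ is a finite state set, $A$ a finite action set, and $0$ is an additional terminal state. For each action $a\in A$ there are transition probabilities $P_{ij}(a)\ge 0$ ($i,j\in S$) with $\sum_{j=1}^nP_{ij}(a)\le 1$ and $P_{i0}(a)=1-\sum_{j=1}^nP_{ij}(a)$; the terminal state is absorbing and cost free. $g:S\times A\to\mathbb{R}$ is the stage cost. A policy is a function $\mu:S\to A$; $\Pi$ is the finite set of policies. $J^\mu(i)=\mathbb{E}\left[\sum_{t=0}^\infty g(s_t,\mu(s_t))\mid s_0=i\right]$, where $s_t$ evolves under $\mu$, and $J^*(i)=\min_{\mu\in\Pi}J^\mu(i)$. A policy is proper if the terminal state is reached with probability 1 from any initial state. Write $P_\mu=(P_{ij}(\mu(i)))$, $g_\mu=(g(i,\mu(i)))_i$. For $J\in\mathbb{R}^n$: $T_\mu J=g_\mu+P_\mu J$ and $TJ(i)=\min_{a\in A}\left[g(i,a)+\sum_{j=1}^nP_{ij}(a)J(j)\right]$. The selections are independent across iterations, with exactly one state selected per iteration (so $\sum_ip(i)=1$), and are independent of the past and of the noise. The $\hat\gamma_t$ are deterministic nonnegative scalars. $w_t(i)$ is the noise in the simulated cumulative cost from state $i$ under $\mu_t$ (observed cost minus its expectation $J^{\mu_t}(i)$); with $\mathcal{F}_t$ the natural filtration of the process up to time $t$ (so $J_t$, $\mu_t$ and the selections made before iteration $t$ are $\mathcal{F}_t$-measurable), $\mathbb{E}[w_t\mid\mathcal{F}_t]=0$ and $\mathbb{E}[\|w_t\|^2\mid\mathcal{F}_t]\le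 C$ for some constant $C$. *)

(* Defs.v *)
From HB Require Import structures.
From mathcomp Require Import all_boot all_order all_algebra.
From mathcomp Require Import all_classical all_reals all_analysis.
Set Implicit Arguments.
Unset Strict Implicit.
Unset Printing Implicit Defensive.
Import Order.TTheory GRing.Theory Num.Theory.
Import numFieldNormedType.Exports.
Local Open Scope classical_set_scope.
Local Open Scope ring_scope.

(* The infimum of a finite family; it is its minimum as soon as the index type
   is nonempty (finmin_attained). *)
Definition finmin (R : realType) (I : finType) (F : I -> R) : R := inf (range F).

Lemma finmin_attained (R : realType) (I : finType) (F : I -> R) (i0 : I) :
  (exists i, finmin F = F i) /\ (forall i, finmin F <= F i).
Proof.
case: (@arg_minP _ _ _ i0 xpredT F erefl) => i _ Fi.
have E : finmin F = F i.
  apply/eqP; rewrite eq_le; apply/andP; split.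
    apply: ge_inf; last by exists i.
    by exists (F i) => _ [j _ <-]; exact: Fi.
  apply: lb_le_inf; first by exists (F i), i.
  by move=> _ [j _ <-]; exact: Fi.
by split=> [|j]; [exists i | rewrite E; exact: Fi].
Qed.

(* State i of {1, ..., n} is an element of 'I_n; [trans i a j] is P_ij(a). *)
Record ssp (R : realType) (n : nat) (A : finType) := SSP {
  trans : 'I_n -> A -> 'I_n -> R ;
  cost : 'I_n -> A -> R ;
  trans_ge0 : forall i a j, 0 <= trans i a j ;
  trans_le1 : forall i a, \sum_j trans i a j <= 1
}.

Definition policy (n : nat) (A : finType) := {ffun 'I_n -> A}.

Section StochasticShortestPath.
Context (R : realType) (n : nat) (A : finType) (M : ssp R n A).

(* The terminal state 0 is represented by None. *)
Definition step_prob (mu : policy n A) (x y : option 'I_n) : R :=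
  match x, y with
  | Some i, Some j => trans M i (mu i) j
  | Some i, None => 1 - \sum_j trans M i (mu i) j
  | None, Some _ => 0
  | None, None => 1
  end.

Definition stage_cost (mu : policy n A) (x : option 'I_n) : R :=
  if x is Some i then cost M i (mu i) else 0.

Section Trajectories.
Context (d : measure_display) (X : measurableType d).

(* Under the probability Q, s is a Markov chain started at i with the
   transition probabilities of mu: P(s_(t+1) = y | s_0 = x_0, ..., s_t = x_t)
   = step_prob mu x_t y, with the conditional probability multiplied out. *)
Definition is_trajectory (mu : policy n A) (i : 'I_n)
    (Q : probability X R) (s : nat -> X -> option 'I_n) : Prop :=
  [/\ forall t x, measurable (s t @^-1` [set x]),
      Q [set v | s 0%N v = Some i] = 1%E
    & forall t (x : nat -> option 'I_n) (y : option 'I_n),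
        Q [set v | (forall k, (k <= t)%N -> s k v = x k) /\ s t.+1 v = y] =
        (Q [set v | forall k, (k <= t)%N -> s k v = x k] *
         (step_prob mu (x t) y)%:E)%E].

Variables (Q : policy n A -> 'I_n -> probability X R)
          (s : nat -> X -> option 'I_n).

Definition proper_policy (mu : policy n A) : Prop :=
  forall i, Q mu i [set v | exists t, s t v = None] = 1%E.

Definition total_cost (mu : policy n A) (v : X) : R :=
  limn (fun N => \sum_(0 <= t < N) stage_cost mu (s t v)).

Definition cost_to_go (mu : policy n A) : 'cV[R]_n :=
  \col_i fine ('E_(Q mu i)[total_cost mu])%E.

Definition optimal_cost : 'cV[R]_n :=
  \col_i finmin (fun mu => cost_to_go mu i 0).

End Trajectories.

Definition trans_mx (mu : policy n A) : 'M[R]_n :=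
  \matrix_(i, j) trans M i (mu i) j.

Definition cost_vec (mu : policy n A) : 'cV[R]_n := \col_i cost M i (mu i).

Definition Tpol (mu : policy n A) (J : 'cV[R]_n) : 'cV[R]_n :=
  cost_vec mu + trans_mx mu *m J.

Definition Topt (J : 'cV[R]_n) : 'cV[R]_n :=
  \col_i finmin (fun a => cost M i a + \sum_j trans M i a j * J j 0).

End StochasticShortestPath.

Section Probability.
Context (R : realType) (d : measure_display) (Omega : measurableType d).
Variable P : probability Omega R.

(* Y is a version of E[X | G], for a sub-sigma-algebra G. *)
Definition is_cond_exp (G : set (set Omega)) (X Y : Omega -> R) : Prop :=
  [/\ P.-integrable setT (EFin \o X),
      P.-integrable setT (EFin \o Y),
      forall B : set R, measurable B -> G (Y @^-1` B)
    & forall E, G E -> (\int[P]_(v in E) (X v)%:E = \int[P]_(v in E) (Y v)%:E)%E].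

(* Independence of a random variable with values in a finite type (with all its
   subsets measurable) from the set system G. *)
Definition independent_from (I : finType) (X : Omega -> I)
    (G : set (set Omega)) : Prop :=
  forall (B : set I) E, G E -> P (X @^-1` B `&` E) = (P (X @^-1` B) * P E)%E.

End Probability.

Section History.
Context (R : realType) (n : nat) (A : finType) (Omega : Type).

Definition vec_events (V : Omega -> 'cV[R]_n) : set (set Omega) :=
  [set E | exists i (B : set R), measurable B /\ E = (fun v => V v i 0) @^-1` B].

Definition fin_events (I : finType) (X : Omega -> I) : set (set Omega) :=
  [set E | exists B : set I, E = X @^-1` B].

(* Generated by J_0, ..., J_t, mu_0, ..., mu_t and the selections strictly
   before iteration t. *)
Definition natural_filtration (J : nat -> Omega -> 'cV[R]_n)
    (mu : nat -> Omega -> policy n A) (sel : nat -> Omega -> 'I_n) (t : nat) :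
    set (set Omega) :=
  <<s [set E | (exists2 k, (k <= t)%N & vec_events (J k) E)
            \/ (exists2 k, (k <= t)%N & fin_events (mu k) E)
            \/ (exists2 k, (k < t)%N & fin_events (sel k) E)] >>.

Definition joined_with (G : set (set Omega)) (V : Omega -> 'cV[R]_n) :
    set (set Omega) :=
  <<s G `|` vec_events V >>.

Definition visits (sel : nat -> Omega -> 'I_n) (t : nat) (v : Omega)
    (i : 'I_n) : nat :=
  \sum_(0 <= k < t.+1) (sel k v == i).

End History.

Definition sqnorm (R : realType) (n : nat) (u : 'cV[R]_n) : R :=
  \sum_i u i 0 ^+ 2.

(* Main.v *)
Require Import Defs.
From HB Require Import structures.
From mathcomp Require Import all_boot all_order all_algebra.
From mathcomp Require Import all_classical all_reals all_analysis.
From mathcomp Require Import measurable_realfun numfun simple_functions measurable_fun_approximation.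
From mathcomp Require Import ring lra.
Set Implicit Arguments.
Unset Strict Implicit.
Unset Printing Implicit Defensive.
Import Order.TTheory GRing.Theory Num.Theory.
Import numFieldNormedType.Exports.
Import HBNNSimple.
Local Open Scope classical_set_scope.
Local Open Scope ring_scope.

(** Why the iterates converge.

    Write c_t(i) for the step that state i receives if it is selected, and g_t
    for a deterministic step common to all states: g_t = 1 / (t + 1) for the
    empirical steps and g_t = ghat_t for the prescribed ones.  Since
    c_t(i) p(i) = g_t (1 + o(1)), averaging over the selection turns the
    asynchronous iteration into

      J_(t+1) = J_t + g_t (J^mu_t - J_t) + g_t o(1) + noise,

    where the noise is the sum of the simulation noise w_t and of the selection
    noise, proportional to (indicator that i is selected) - p(i).  Both are
    martingale differences with summable variances, so that their series, also
    weighted by coefficients known at time t, converge almost surely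
    ([martingale_series_cvg], [noise_series_cvg], [selection_series_cvg]).  The
    variance of the selection noise involves J_t, which has no a priori moment;
    J_t is therefore truncated at an arbitrary level, and the pathwise bound
    [averaging_bounded] shows that some level is never exceeded.

    What remains is deterministic and relies on one scalar fact,
    [averaging_limsup_le0]: a recursion x' <= (1 - g) x + g e + z with
    divergent sum of g, limsup e <= 0 and convergent sum of z has
    limsup x <= 0, because the tails of the series of z can be absorbed in x.
    It is used three times.

    - Since T J_(t+1) <= T_mu_t J_(t+1) and T_mu_t is affine with fixed point
      J^mu_t, the gap T J_t - J_t satisfies such a recursion, whose noise is
      the one above multiplied by P_mu_t - I.  Hence limsup (T J_t - J_t) <= 0
      ([bellman_gap_limsup]).
    - By the maximum principle for P_mu_t, an upper bound on T J_t - J_t gives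
      J^mu_t <= T J_t + o(1) <= T_mu J_t + o(1) for every policy mu
      ([policy_cost_upper]).  For an optimal mu, T_mu contracts a weighted
      supremum norm, so that limsup (J_t - J* ) <= 0 ([iterates_upper]).
    - Conversely J^mu_t >= J* gives liminf (J_t - J* ) >= 0
      ([iterates_lower]).

    Properness enters through the maximum principle
    (x <= P_mu x implies x <= 0): along the chain started at i, the expectation
    of x does not decrease, and it tends to 0 as the chain is absorbed
    ([subharmonic_le0]).  It makes I - P_mu invertible and identifies J^mu with
    the solution of J = g_mu + P_mu J ([expected_total_cost]); a policy that
    minimises the sum of the costs over all initial states is then optimal from
    every state ([optimal_policy]). *)

(** * Integrals against functions measurable for a generated sigma-algebra *)

Section OrthogonalTests.
Context (R : realType) (d : measure_display) (Omega : measurableType d).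
Variable P : probability Omega R.

(** Measurability for the sigma-algebra generated by H.  Phrasing it through
    the type that carries this sigma-algebra makes the closure properties of
    measurable functions available. *)
Definition gen_measurable (H : set (set Omega)) (f : Omega -> R) : Prop :=
  measurable_fun [set: g_sigma_algebraType H] (f : g_sigma_algebraType H -> R).

Lemma gen_measurable_preimage (H : set (set Omega)) f B :
  gen_measurable H f -> measurable B -> <<s H >> (f @^-1` B).
Proof. by move=> mf mB; have := mf measurableT B mB; rewrite setTI. Qed.

Lemma gen_measurable_measurable (H : set (set Omega)) f :
  H `<=` measurable -> gen_measurable H f -> measurable_fun setT f.
Proof.
move=> Hm mf _ B mB.
rewrite setTI.
exact: (smallest_sub (sigma_algebra_measurable _) Hm
  (gen_measurable_preimage mf mB)).
Qed.

Lemma gen_measurable_sub (H H' : set (set Omega)) f :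
  H `<=` <<s H' >> -> gen_measurable H f -> gen_measurable H' f.
Proof.
move=> HH' mf _ B mB; rewrite setTI.
apply: (smallest_sub _ HH' (gen_measurable_preimage mf mB)).
exact: smallest_sigma_algebra.
Qed.

(** Simple functions measurable for the generated sigma-algebra increase to Z,
    and W integrates to 0 against each of them; domination by |W Z| passes this
    to the limit. *)
Lemma integral_test_ge0 (H : set (set Omega)) (W Z : Omega -> R) :
  H `<=` measurable ->
  P.-integrable setT (EFin \o W) ->
  (forall E, <<s H >> E -> \int[P]_(x in E) (W x)%:E = 0)%E ->
  gen_measurable H Z -> (forall x, 0 <= Z x) ->
  P.-integrable setT (fun x => (W x * Z x)%:E) ->
  (\int[P]_x (W x * Z x)%:E = 0)%E.
Proof.
move=> Hm iW W0 mZ Z0 iWZ.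
have mE : measurable_fun [set: g_sigma_algebraType H] 
    (EFin \o (Z : g_sigma_algebraType H -> R)).
  exact/measurable_EFinP.
have mT := @measurableT _ (g_sigma_algebraType H).
pose g := nnsfun_approx mT mE.
have gcvg x : (EFin \o g^~ x) @ \oo --> (Z x)%:E.
  apply: (cvg_nnsfun_approx mT mE) => //= y _; by rewrite lee_fin.
have gle k x : g k x <= Z x.
  rewrite -lee_fin /g nnsfun_approxE.
  by apply: (@le_approx _ _ _ _ (EFin \o Z)) => //= y _; rewrite lee_fin.
have mg k : measurable_fun setT (g k : Omega -> R).
  apply: (gen_measurable_measurable Hm).
  exact: measurable_funP.
have mW : measurable_fun setT W by exact/measurable_EFinP/(measurable_int P).
have g0 k : (\int[P]_x (W x * g k x)%:E = 0)%E.
  under eq_integral.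
    move=> x _; rewrite (fimfunEord (g k)) mulr_sumr -sumEFin.
    over.
  have mpre k' y : measurable (g k' @^-1` [set y] : set Omega).
    by rewrite -[X in measurable X]setTI; apply: mg.
  have iWi y : P.-integrable setT
      (fun x => (W x * (y * \1_(g k @^-1` [set y] : set Omega) x))%:E).
    have -> : (fun x => (W x * (y * \1_(g k @^-1` [set y] : set Omega) x))%:E) =
        (fun x => y%:E * ((EFin \o W) \_ (g k @^-1` [set y])) x)%E.
      apply/funext => x; rewrite /patch indicE.
      by case: ifP => _ /=; rewrite ?mule0 ?mulr0 // -EFinM; congr EFin; ring.
    apply: integrableZl => //.
    apply/(integrable_mkcond (EFin \o W) (mpre k y)).1.
    exact: (integrableS measurableT).
  rewrite integral_sum //.
  apply: big1 => i _.
  set y := _`_i.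
  have -> : (fun x => (W x * (y * \1_(g k @^-1` [set y] : set Omega) x))%:E) =
        (fun x => y%:E * ((EFin \o W) \_ (g k @^-1` [set y])) x)%E.
      apply/funext => x; rewrite /patch indicE.
      by case: ifP => _ /=; rewrite ?mule0 ?mulr0 // -EFinM; congr EFin; ring.
  rewrite integralZl //; last first.
    apply/(integrable_mkcond (EFin \o W) (mpre k y)).1.
    exact: (integrableS measurableT).
  rewrite -integral_mkcond W0 ?mule0 //.
  apply: (gen_measurable_preimage (f := g k)); last exact: measurable_set1.
  exact: measurable_funP.
have h : (\int[P]_x (W x * g k x)%:E)%E @[k --> \oo] -->
    (\int[P]_x (W x * Z x)%:E)%E.
  apply: (@dominated_cvg _ _ _ P setT measurableT _ _
    (fun x => `|W x * Z x|%:E)) => //.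
  - by move=> k; apply/measurable_EFinP/measurable_funM.
  - move=> x _; under eq_fun do rewrite EFinM.
    rewrite EFinM; apply: cvgeZl => //; exact: gcvg.
  - exact: integrable_norm.
  - move=> k x _ /=; rewrite lee_fin !normrM ler_wpM2l //.
    rewrite !ger0_norm //; exact: gle.
have : (fun=> 0%E : \bar R) @ \oo --> (\int[P]_x (W x * Z x)%:E)%E.
  apply: cvg_trans h.
  by apply: near_eq_cvg; near=> k; rewrite g0.
move/cvg_lim => <- //.
by rewrite lim_cst.
Unshelve. all: by end_near. Qed.

(** The only property of conditional expectations and of independence used
    below: a W with integral 0 on all events of a sigma-algebra is orthogonal to
    all functions measurable for it, as soon as the product is integrable. *)
Lemma integral_test (H : set (set Omega)) (W Z : Omega -> R) :
  H `<=` measurable ->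
  P.-integrable setT (EFin \o W) ->
  (forall E, <<s H >> E -> \int[P]_(x in E) (W x)%:E = 0)%E ->
  gen_measurable H Z ->
  P.-integrable setT (fun x => (W x * Z x)%:E) ->
  (\int[P]_x (W x * Z x)%:E = 0)%E.
Proof.
move=> Hm iW W0 mZ iWZ.
have mW : measurable_fun setT W by exact/measurable_EFinP/(measurable_int P).
have mZm := gen_measurable_measurable Hm mZ.
have ip : P.-integrable setT (fun x => (W x * Z^\+ x)%:E).
  apply: le_integrable iWZ => //.
    by apply/measurable_EFinP/measurable_funM => //; exact: measurable_funrpos.
  move=> x _; rewrite /= lee_fin !normrM ler_wpM2l // ger0_norm ?funrpos_ge0 //.
  by rewrite /funrpos ge_max normr_ge0 ler_norm.
have iN : P.-integrable setT (fun x => (W x * Z^\- x)%:E).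
  apply: le_integrable iWZ => //.
    by apply/measurable_EFinP/measurable_funM => //; exact: measurable_funrneg.
  move=> x _; rewrite /= lee_fin !normrM ler_wpM2l // ger0_norm ?funrneg_ge0 //.
  by rewrite /funrneg ge_max normr_ge0 -normrN ler_norm.
under eq_integral.
  move=> x _; rewrite (_ : W x * Z x = W x * Z^\+ x - W x * Z^\- x).
    rewrite EFinB; over.
  by rewrite -mulrBr -[in LHS](funrposBneg Z).
rewrite integralB //.
rewrite !(@integral_test_ge0 H) ?sube0 //.
- exact: measurable_funrneg.
- exact: measurable_funrpos.
Qed.
End OrthogonalTests.

(** * Almost sure convergence of square-summable martingale series *)

Lemma measurable_natr_bool (R : realType) d (T : measurableType d)
  (b : T -> bool) :
  measurable_fun setT b -> measurable_fun setT (fun x => (b x)%:R : R).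
Proof.
move=> mb; rewrite (_ : (fun x => _) = (fun x => if b x then 1 else 0)).
  by apply: measurable_fun_ifT => //; exact: measurable_cst.
by apply/funext => x; case: (b x).
Qed.

Section Martingale.
Context (R : realType) (d : measure_display) (Omega : measurableType d).
Variable P : probability Omega R.

(** The partial sums of xi, frozen once they leave the interval (-eps, eps).
    Whether step k is frozen is read off the frozen sum itself, so that no
    stopping time has to be introduced. *)
Fixpoint stopped_sum (xi : nat -> Omega -> R) (eps : R) (k : nat) (x : Omega) : R :=
  if k is k'.+1 then
    let S := stopped_sum xi eps k' x in
    S + xi k' x * (`|S| < eps)%R%:R
  else 0.

Lemma stopped_sum_ge (xi : nat -> Omega -> R) eps N x :
  (exists2 k, (k <= N)%N & eps <= `|\sum_(0 <= t < k) xi t x|) ->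
  eps <= `|stopped_sum xi eps N x|.
Proof.
suff H k : (stopped_sum xi eps k x = \sum_(0 <= t < k) xi t x /\
    forall j, (j < k)%N -> `|\sum_(0 <= t < j) xi t x| < eps)
  \/ eps <= `|stopped_sum xi eps k x|.
  move=> [k kN ek]; case: (H N) => [[eN lN]|//].
  move: kN; rewrite leq_eqVlt => /predU1P[kN|/lN].
    by rewrite eN -kN.
  by rewrite ltNge ek.
elim: k => [|k [[ek lk]|ek]] /=.
- by left; split=> //; rewrite big_geq.
- rewrite ek big_nat_recr //=; case: ltP => [lt|ge]; last first.
    by right; rewrite mulr0 addr0.
  left; split; first by rewrite mulr1.
  by move=> j; rewrite ltnS leq_eqVlt => /predU1P[->//|/lk].
- by right; rewrite ltNge ek mulr0 addr0.
Qed.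

(** Because |f| <= 1 + f^2 and P is finite. *)
Lemma integrable_sqr_integrable (f : Omega -> R) :
  measurable_fun setT f -> P.-integrable setT (fun x => (f x ^+ 2)%:E) ->
  P.-integrable setT (EFin \o f).
Proof.
move=> mf i2.
have i1 : P.-integrable setT (fun x => (1 + f x ^+ 2)%:E).
  rewrite (_ : (fun x => _) = (cst 1%:E \+ (fun x => (f x ^+ 2)%:E))%E);
    last by apply/funext.
  by apply: integrableD => //; exact: finite_measure_integrable_cst.
apply: le_integrable i1 => //; first exact/measurable_EFinP.
move=> x _ /=; rewrite lee_fin (ger0_norm (_ : 0 <= 1 + f x ^+ 2)).
  rewrite -[f x ^+ 2]real_normK ?num_real //.
  have := normr_ge0 (f x); nra.
by rewrite addr_ge0 ?sqr_ge0.
Qed.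

Lemma integrable_bounded_mul (f Z : Omega -> R) (b : R) :
  P.-integrable setT (EFin \o f) -> measurable_fun setT Z ->
  (forall x, `|Z x| <= b) -> P.-integrable setT (fun x => (f x * Z x)%:E).
Proof.
move=> i mZ bZ.
have mf : measurable_fun setT f by exact/measurable_EFinP/(measurable_int P).
have ib : P.-integrable setT (fun x => (b%:E * (EFin \o f) x)%E).
  exact: integrableZl.
apply: le_integrable ib => //.
  by apply/measurable_EFinP/measurable_funM.
move=> x _ /=; rewrite lee_fin normrM [leRHS]normrM mulrC ler_pM //.
exact: le_trans (ler_norm b).
Qed.

Section Maximal.
Variables (F : nat -> set (set Omega)) (xi : nat -> Omega -> R).
Hypothesis Fm : forall t, F t `<=` measurable.
Hypothesis Fmono : forall t, F t `<=` <<s F t.+1 >>.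
Hypothesis xi_adapted : forall t, gen_measurable (F t.+1) (xi t).
Hypothesis xi_sqr : forall t, P.-integrable setT (fun x => (xi t x ^+ 2)%:E).
Hypothesis xi_orth : forall t (Z : Omega -> R) (b : R), gen_measurable (F t) Z ->
  (forall x, `|Z x| <= b) -> \int[P]_x (xi t x * Z x) = 0.

Lemma stopped_sum_gen_measurable eps k :
  gen_measurable (F k) (stopped_sum xi eps k).
Proof.
elim: k => [|k IH] /=; first exact: measurable_cst.
have IH' := gen_measurable_sub (Fmono (t := k)) IH.
apply: measurable_funD => //.
apply: measurable_funM; first exact: xi_adapted.
apply: measurable_natr_bool.
apply: measurable_fun_ltr; last exact: measurable_cst.
exact: (measurableT_comp (@normr_measurable R setT)).
Qed.

Let mxi t : measurable_fun setT (xi t).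
Proof. exact (gen_measurable_measurable (@Fm t.+1) (@xi_adapted t)). Qed.

Let mT eps k : measurable_fun setT (stopped_sum xi eps k).
Proof.
exact (gen_measurable_measurable (@Fm k)
  (@stopped_sum_gen_measurable eps k)).
Qed.

(** The increments added to the frozen sum are orthogonal to it: as long as
    it moves, the frozen sum is bounded by eps and known before the increment. *)
Lemma stopped_sum_sqr eps k :
  P.-integrable setT (fun x => (stopped_sum xi eps k x ^+ 2)%:E) /\
  \int[P]_x (stopped_sum xi eps k x ^+ 2) <=
  \sum_(0 <= t < k) \int[P]_x (xi t x ^+ 2).
Proof.
elim: k => [|k [IHi IH]] /=.
  rewrite big_geq // expr0n /=; split; first exact: integrable0.
  by rewrite Rintegral_cst // mul0r.
set T := stopped_sum xi eps k in IHi IH *.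
pose B x : R := (`|T x| < eps)%R%:R.
have mB : gen_measurable (F k) B.
  apply: measurable_natr_bool.
  apply: measurable_fun_ltr; last exact: measurable_cst.
  apply: (measurableT_comp (@normr_measurable R setT)).
  exact: stopped_sum_gen_measurable.
have mTk : gen_measurable (F k) T by exact: stopped_sum_gen_measurable.
pose Z x := T x * B x.
have mZ : gen_measurable (F k) Z by exact: measurable_funM.
have bZ x : `|Z x| <= `|eps|.
  rewrite /Z /B; case: ltP => h; rewrite ?mulr0 ?normr0 ?mulr1 //.
  exact: le_trans (ltW h) (ler_norm _).
have bB x : `|B x| <= 1 by rewrite /B; case: ltP; rewrite ?normr1 ?normr0.
have ixi := integrable_sqr_integrable (mxi k) (xi_sqr k).
have mZ' := gen_measurable_measurable (Fm (t := k)) mZ.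
have mB' := gen_measurable_measurable (Fm (t := k)) mB.
have i1 := integrable_bounded_mul ixi mZ' bZ.
have i2 := integrable_bounded_mul (xi_sqr k) mB' bB.
have E : (fun x => (T x + xi k x * B x) ^+ 2) =
    (fun x => T x ^+ 2 + (2 * (xi k x * Z x) + xi k x ^+ 2 * B x)).
  apply/funext => x; rewrite /Z.
  have [->|->] : B x = 0 \/ B x = 1 by rewrite /B; case: ltP; [right|left].
    by ring.
  by ring.
have i3 : P.-integrable setT (fun x => (2 * (xi k x * Z x))%:E).
  by under eq_fun do rewrite EFinM; exact: integrableZl.
have i4 : P.-integrable setT
    (fun x => (2 * (xi k x * Z x) + xi k x ^+ 2 * B x)%:E).
  by under eq_fun do rewrite EFinD; exact: integrableD.
split.
  have -> : (fun x => ((T x + xi k x * B x) ^+ 2)%:E) =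
      (fun x => (T x ^+ 2)%:E + (2 * (xi k x * Z x) + xi k x ^+ 2 * B x)%:E)%E.
    by apply/funext => x; rewrite -EFinD -(congr1 (@^~ x) E).
  exact: integrableD.
rewrite E.
rewrite RintegralD // RintegralD // RintegralZl // (xi_orth mZ bZ) mulr0 add0r.
rewrite big_nat_recr //=; apply: lerD => //.
apply: le_Rintegral => //; first exact: xi_sqr.
move=> x _ /=.
by rewrite -[leRHS]mulr1 ler_wpM2l ?sqr_ge0 // /B; case: ltP.
Qed.

(** Kolmogorov's inequality, by applying Chebyshev's inequality to the frozen
    sum, which ends outside (-eps, eps) as soon as the partial sums ever leave it. *)
Lemma maximal_inequality (eps : R) N : 0 < eps ->
  (P [set x | exists2 k, (k <= N)%N &
        (eps <= `|\sum_(0 <= t < k) xi t x|)%R] <=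
   ((\sum_(0 <= t < N) \int[P]_x (xi t x ^+ 2)) / eps ^+ 2)%:E)%E.
Proof.
move=> e0; pose A := [set x | eps <= `|stopped_sum xi eps N x|].
have mA : measurable A.
  rewrite -[A]setTI.
  apply: (@measurable_fun_ler _ _ _ setT (cst eps)
    (fun x => `|stopped_sum xi eps N x|)) => //.
  exact: (measurableT_comp (@normr_measurable R setT)).
have [iT leT] := stopped_sum_sqr eps N.
have mS : measurable
    [set x | exists2 k, (k <= N)%N & eps <= `|\sum_(0 <= t < k) xi t x|].
  rewrite (_ : [set x | _] = \bigcup_(k in [set k | (k <= N)%N])
      [set x | eps <= `|\sum_(0 <= t < k) xi t x|]); last first.
    by apply/seteqP; split=> x [k kN ek]; exists k.
  apply: bigcup_measurable => k _.
  rewrite -[X in measurable X]setTI.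
  apply: (@measurable_fun_ler _ _ _ setT (cst eps)
    (fun x => `|\sum_(0 <= t < k) xi t x|)) => //.
  apply: (measurableT_comp (@normr_measurable R setT)).
  exact: measurable_sum.
apply: (@le_trans _ _ (P A)).
  by apply: le_measure; rewrite ?inE // => x; exact: stopped_sum_ge.
rewrite -[X in (X <= _)%E]fineK ?fin_num_measure // lee_fin.
rewrite ler_pdivlMr ?exprn_gt0 //; apply: le_trans leT.
have -> : fine (P A) * eps ^+ 2 = \int[P]_x (\1_A x * eps ^+ 2).
  have iA : P.-integrable setT (EFin \o (\1_A : Omega -> R)).
    by apply: integrable_indic.
  by rewrite RintegralZr // /Rintegral /= integral_indic // setIT.
apply: le_Rintegral => //.
- have iA : P.-integrable setT (EFin \o (\1_A : Omega -> R)).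
    by apply: integrable_indic.
  exact: (@integrableZr _ _ _ P setT measurableT (eps ^+ 2) _ iA).
- move=> x _; rewrite indicE; case: (boolP (x \in A)) => [|_].
    rewrite inE /A /= => h.
    by rewrite mul1r -[leRHS]real_normK ?num_real // lerXn2r ?nnegrE // ltW.
  by rewrite mul0r sqr_ge0.
Qed.

End Maximal.

Lemma sum_nat_shift (u : nat -> R) m k :
  \sum_(0 <= t < m + k) u t = \sum_(0 <= t < m) u t + \sum_(0 <= t < k) u (m + t)%N.
Proof.
elim: k => [|k IH]; first by rewrite addn0 [X in _ + X]big_geq ?addr0.
by rewrite addnS !big_nat_recr //= IH addrA.
Qed.

Lemma cvgn_small_tails (S : nat -> R) :
  (forall q : nat, exists m, forall k, `|S (m + k)%N - S m| < q.+1%:R^-1) ->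
  cvgn S.
Proof.
move=> H; apply/cauchy_cvgP; apply: cauchy_exP => e e0.
have [q qe] : exists q : nat, q.+1%:R^-1 < e.
  near \oo => q; exists q; near: q; exact: near_infty_natSinv_lt (PosNum e0).
have [m hm] := H q; exists (S m).
exists m => //= k /= mk; rewrite /ball /= distrC.
by rewrite -(subnKC mk); exact: lt_trans (hm _) qe.
Unshelve. all: by end_near. Qed.

(** A common bound for all blocks starting at m, which is the form in which
    convergence enters the maximal inequality. *)
Lemma bounded_series_tail (v : nat -> R) (V : R) :
  (forall t, 0 <= v t) -> (forall N, \sum_(0 <= t < N) v t <= V) ->
  forall e, 0 < e -> exists m, forall k, \sum_(0 <= t < k) v (m + t)%N <= e.
Proof.
move=> v0 vV e e0.
have hb : has_ubound (range (series v)) by exists V => _ [N _ <-]; exact: vV.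
have nd : nondecreasing_seq (series v).
  by apply: nondecreasing_series => n _ _; exact: v0.
have /cvg_ex[/= l vl] := nondecreasing_is_cvgn nd hb.
have lub N : series v N <= l.
  rewrite -(cvg_lim _ vl) //; apply: nondecreasing_cvgn_le => //.
  by apply/cvg_ex; exists l.
have /cvgrPdist_le /(_ e e0) [m _ hm] := vl.
exists m => k.
have := hm m (leqnn m); rewrite ger0_norm ?subr_ge0 // => h1.
have := lub (m + k)%N; rewrite /series /= sum_nat_shift => h2.
rewrite /series /= in h1; lra.
Qed.

(** By the maximal inequality for the blocks starting at m, the oscillation of
    the partial sums after time m exceeds 1 / (q + 1) with a probability that
    tends to 0 as m grows; hence almost every path is Cauchy. *)
Theorem martingale_series_cvg (F : nat -> set (set Omega))
    (xi : nat -> Omega -> R) (V : R) :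
  (forall t, F t `<=` measurable) -> (forall t, F t `<=` <<s F t.+1 >>) ->
  (forall t, gen_measurable (F t.+1) (xi t)) ->
  (forall t, P.-integrable setT (fun x => (xi t x ^+ 2)%:E)) ->
  (forall t (Z : Omega -> R) (b : R), gen_measurable (F t) Z ->
    (forall x, `|Z x| <= b) -> \int[P]_x (xi t x * Z x) = 0) ->
  (forall N, \sum_(0 <= t < N) \int[P]_x (xi t x ^+ 2) <= V) ->
  {ae P, forall x, cvgn (fun N => \sum_(0 <= t < N) xi t x)}.
Proof.
move=> Fm Fmono xi_ad xi_sqr xi_orth xiV.
have mxi t : measurable_fun setT (xi t).
  exact: (gen_measurable_measurable (@Fm t.+1) (@xi_ad t)).
pose S q m N := [set x | exists2 k, (k <= N)%N &
  q.+1%:R^-1 <= `|\sum_(0 <= t < k) xi (m + t)%N x|].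
have mS q m N : measurable (S q m N).
  rewrite (_ : S q m N = \bigcup_(k in [set k | (k <= N)%N])
      [set x | q.+1%:R^-1 <= `|\sum_(0 <= t < k) xi (m + t)%N x|]); last first.
    by apply/seteqP; split=> x [k kN ek]; exists k.
  apply: bigcup_measurable => k _.
  rewrite -[X in measurable X]setTI.
  apply: (@measurable_fun_ler _ _ _ setT (cst q.+1%:R^-1)
    (fun x => `|\sum_(0 <= t < k) xi (m + t)%N x|)) => //.
  apply: (measurableT_comp (@normr_measurable R setT)).
  by apply: measurable_sum => t.
pose A q m := \bigcup_N S q m N.
have mA q m : measurable (A q m) by exact: bigcup_measurable.
have PA q e : 0 < e -> exists m, (P (A q m) <= e%:E)%E.
  move=> e0; have q0 : (0 : R) < q.+1%:R^-1 by [].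
  have e'0 : 0 < e * q.+1%:R^-1 ^+ 2 by rewrite mulr_gt0 ?exprn_gt0.
  have v0 t : 0 <= \int[P]_x (xi t x ^+ 2).
    by apply: Rintegral_ge0 => x _; exact: sqr_ge0.
  have [m hm] := bounded_series_tail v0 xiV e'0.
  exists m.
  have nd : nondecreasing_seq (S q m).
    move=> a b ab; apply/subsetPset => x [k ka ek].
    by exists k => //; exact: leq_trans ka ab.
  have cA := nondecreasing_cvg_mu (mS q m) (mA q m) nd (mu := P).
  rewrite -(cvg_lim _ cA) //; apply: lime_le; first by apply/cvg_ex; exists (P (A q m)).
  apply: nearW => N /=.
  apply: le_trans (@maximal_inequality (fun t => F (m + t)%N)
    (fun t => xi (m + t)%N) _ _ _ _ _ q.+1%:R^-1 N q0) _ => //.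
  - by move=> t; rewrite addnS.
  - by move=> t; rewrite addnS; exact: xi_ad.
  - by move=> t Z b; exact: xi_orth.
  by rewrite lee_fin ler_pdivrMr ?exprn_gt0.
have : P.-negligible (\bigcup_q \bigcap_m A q m).
  apply: negligible_bigcup => q.
  have mI : measurable (\bigcap_m A q m) by exact: bigcap_measurableType.
  apply/negligibleP => //; apply/eqP; rewrite -measure_le0.
  apply/lee_addgt0Pr => e e0; rewrite add0e.
  have [m hm] := PA q e e0.
  apply: le_trans hm; apply: le_measure; rewrite ?inE // => x; exact.
apply: negligibleS => x /= ncv; apply: contrapT => nx; apply: ncv.
apply: cvgn_small_tails => q; apply: contrapT => nm; apply: nx.
exists q => // m _; apply: contrapT => nAx; apply: nm; exists m => k.
rewrite ltNge; apply/negP => h; apply: nAx; exists k => //=; exists k => //.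
by move: h; rewrite sum_nat_shift addrAC subrr add0r.
Qed.

End Martingale.

(** * Averaging recursions for real sequences *)

Section ScalarRecursions.
Context (R : realType).

Definition limsup_le0 (x : nat -> R) : Prop :=
  forall e, 0 < e -> \forall t \near \oo, x t <= e.

Definition divergent_sum (g : nat -> R) : Prop :=
  forall K, exists N, K <= \sum_(0 <= t < N) g t.

Lemma series_tail_vanishes (z : nat -> R) (l : R) :
  (fun N => \sum_(0 <= t < N) z t) @ \oo --> l ->
  forall e, 0 < e ->
    \forall t \near \oo, `|l - \sum_(0 <= k < t) z k| <= e.
Proof. by move=> /cvgrPdist_le zl e e0; exact: zl. Qed.

Lemma divergent_sum_tail (g : nat -> R) m K :
  divergent_sum g -> (forall t, 0 <= g t) ->
  exists2 N, (m <= N)%N & K <= \sum_(m <= t < N) g t.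
Proof.
move=> div g0.
have [N hN] := div (K + \sum_(0 <= t < m) g t).
have s0 a b : 0 <= \sum_(a <= t < b) g t by apply: sumr_ge0.
exists (maxn m N); first exact: leq_maxl.
have h : \sum_(0 <= t < N) g t <= \sum_(0 <= t < maxn m N) g t.
  rewrite (@big_cat_nat _ _ _ N 0 (maxn m N)) //= ?leq_maxr //.
  by rewrite lerDl.
rewrite (@big_cat_nat _ _ _ m 0 (maxn m N)) //= ?leq_maxl // in h.
lra.
Qed.

(** With Z_t the tail of the series of z, the sequence x + Z obeys the same
    recursion with z absorbed in the vanishing term e + Z.  As long as x + Z
    stays above a positive level, it decreases by at least a multiple of g, which
    the divergence of the sum of g does not permit forever; once below, it stays
    below. *)
Lemma averaging_limsup_le0 (g x e z : nat -> R) :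
  (forall t, 0 <= g t) -> (\forall t \near \oo, g t <= 1) ->
  divergent_sum g -> limsup_le0 e ->
  cvgn (fun N => \sum_(0 <= t < N) z t) ->
  (\forall t \near \oo, x t.+1 <= (1 - g t) * x t + g t * e t + z t) ->
  limsup_le0 x.
Proof.
move=> g0 g1 div le0 /cvg_ex[/= l zl] xrec eps eps0.
pose Z t := l - \sum_(0 <= k < t) z k.
have eta0 : 0 < eps / 4 by rewrite divr_gt0.
have [m _ hm] : \forall t \near \oo,
    [/\ g t <= 1, e t <= eps / 4, `|Z t| <= eps / 4 &
      x t.+1 <= (1 - g t) * x t + g t * e t + z t].
  near=> t; split; first by near: t.
  - by near: t; exact: le0.
  - by near: t; exact: series_tail_vanishes.
  - by near: t.
pose y t := x t + Z t - eps / 2.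
have yrec t : (m <= t)%N -> y t.+1 <= (1 - g t) * y t.
  move=> /hm[/= g1t et Zt xt].
  have ZS : Z t.+1 = Z t - z t by rewrite /Z big_nat_recr //=; ring.
  have : e t + Z t <= eps / 2.
    by move: Zt; rewrite ler_norml => /andP[_ Zt]; lra.
  rewrite /y ZS => h.
  have := ler_wpM2l (g0 t) h; nra.
(* Two quarters of eps bound the perturbation e + Z and are subtracted in y,
   one is the level that y reaches, one pays for removing Z at the end. *)
have [s ms ys] : exists2 s, (m <= s)%N & y s <= eps / 4.
  apply: contrapT => ny.
  have big t : (m <= t)%N -> eps / 4 <= y t.
    move=> mt; apply/ltW; rewrite ltNge; apply/negP => h; apply: ny.
    by exists t.
  have dec k : y (m + k)%N <= y m - eps / 4 * \sum_(m <= t < m + k) g t.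
    elim: k => [|k IH]; first by rewrite addn0 big_geq // mulr0 subr0.
    rewrite addnS big_nat_recr ?leq_addr //=.
    have h1 := yrec _ (leq_addr k m); have h2 := big _ (leq_addr k m).
    have := ler_wpM2l (g0 (m + k)%N) h2; lra.
  have [N mN hN] := divergent_sum_tail m (y m / (eps / 4)) div g0.
  have := dec (N - m)%N; rewrite subnKC // => h.
  have hb := big _ mN.
  rewrite ler_pdivrMr // in hN; lra.
exists s => // t /= st.
have : y t <= eps / 4.
  rewrite -(subnKC st); elim: (t - s)%N => [|k IH]; first by rewrite addn0.
  have ms' : (m <= s + k)%N by rewrite (leq_trans ms) ?leq_addr.
  rewrite addnS; apply: le_trans (yrec _ ms') _.
  have [/= g1t _ _ _] := hm _ ms'; have := g0 (s + k)%N.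
  nra.
have [/= _ _ Zt _] := hm _ (leq_trans ms st).
move: Zt; rewrite ler_norml /y => /andP[Zt _]; lra.
Unshelve. all: by end_near. Qed.

(** Absorbing the tail of z as before, each step with a <= 1 is a convex
    combination of bounded quantities. *)
Lemma averaging_bounded (a b x z : nat -> R) (B : R) :
  (forall t, 0 <= a t) -> (\forall t \near \oo, a t <= 1) ->
  (forall t, `|b t| <= B) -> cvgn (fun N => \sum_(0 <= t < N) z t) ->
  (forall t, x t.+1 = x t + a t * (b t - x t) + z t) ->
  exists K, forall t, `|x t| <= K.
Proof.
move=> a0 [m _ a1] bB zc xrec.
have /cvg_ex[/= l zl] := zc.
pose Z t := l - \sum_(0 <= k < t) z k.
have [M hM] : exists M, forall t, `|Z t| <= M.
  have [M [_ hM]] := cvg_seq_bounded zc.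
  exists (`|l| + (M + 1)) => t; rewrite /Z.
  apply: le_trans (ler_normB _ _) _; rewrite lerD2l.
  by apply: hM => //; rewrite ltrDl.
pose y t := x t + Z t.
pose D := Num.max `|y m| (B + M).
have hy k : `|y (m + k)%N| <= D.
  elim: k => [|k IH]; first by rewrite addn0 /D le_max lexx.
  rewrite addnS; set t := (m + k)%N in IH *.
  have -> : y t.+1 = (1 - a t) * y t + a t * (b t + Z t).
    by rewrite /y xrec /Z big_nat_recr //=; ring.
  apply: le_trans (ler_normD _ _) _; rewrite !normrM.
  have a1t : a t <= 1 by apply: a1; rewrite /= leq_addr.
  rewrite (ger0_norm (a0 t)) ger0_norm ?subr_ge0 //.
  have h : `|b t + Z t| <= D.
    apply: le_trans (ler_normD _ _) _.
    by rewrite /D le_max (lerD (bB t) (hM t)) orbT.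
  have := ler_wpM2l (a0 t) h.
  have s0 : 0 <= 1 - a t by rewrite subr_ge0.
  have := ler_wpM2l s0 IH; lra.
have M0 : 0 <= M by apply: le_trans (hM 0%N).
have D0 : 0 <= D by apply: le_trans (hy 0%N).
exists (D + M + \sum_(t < m) `|x t|) => t.
have [tm|mt] := ltnP t m.
  rewrite (bigD1 (Ordinal tm)) //=.
  have : 0 <= \sum_(i < m | i != Ordinal tm) `|x i| by apply: sumr_ge0.
  lra.
have : 0 <= \sum_(i < m) `|x i| by apply: sumr_ge0.
have := hy (t - m)%N; rewrite subnKC // => h.
have -> : x t = y t - Z t by rewrite /y addrK.
have := ler_normB (y t) (Z t); have := hM t; lra.
Qed.

End ScalarRecursions.

Section LimsupAlgebra.
Context (R : realType).
Implicit Types x y : nat -> R.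

Lemma limsup_le0_le x y : (\forall t \near \oo, x t <= y t) ->
  limsup_le0 y -> limsup_le0 x.
Proof.
move=> xy y0 e e0; near=> t; apply: (@le_trans _ _ (y t)); first by near: t.
by near: t; exact: y0.
Unshelve. all: by end_near. Qed.

Lemma limsup_le0D x y : limsup_le0 x -> limsup_le0 y ->
  limsup_le0 (fun t => x t + y t).
Proof.
move=> x0 y0 e e0; have e20 : 0 < e / 2 by rewrite divr_gt0.
near=> t; rewrite [e]splitr; apply: lerD; near: t; [exact: x0|exact: y0].
Unshelve. all: by end_near. Qed.

Lemma limsup_le0_scale (c : R) x : 0 <= c -> limsup_le0 x ->
  limsup_le0 (fun t => c * x t).
Proof.
move=> c0 x0 e e0; have c1 : 0 < c + 1 by lra.
near=> t; have : x t <= e / (c + 1).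
  by near: t; apply: x0; rewrite divr_gt0.
rewrite ler_pdivlMr // => h.
have [x0'|x0'] := leP 0 (x t); nra.
Unshelve. all: by end_near. Qed.

Lemma limsup_le0_sum (I : finType) (x : I -> nat -> R) :
  (forall i, limsup_le0 (x i)) -> limsup_le0 (fun t => \sum_i x i t).
Proof.
move=> x0; rewrite /index_enum; elim: Finite.enum => [|i s IH].
  by move=> e e0; near=> t; rewrite big_nil ltW.
have -> : (fun t => \sum_(j <- i :: s) x j t) =
    (fun t => x i t + \sum_(j <- s) x j t).
  by apply/funext => t; rewrite big_cons.
exact: limsup_le0D.
Unshelve. all: by end_near. Qed.

Lemma limsup_le0_max0 x : limsup_le0 x -> limsup_le0 (fun t => Num.max (x t) 0).
Proof.
move=> x0 e e0; near=> t; rewrite ge_max (ltW e0) andbT; near: t; exact: x0.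
Unshelve. all: by end_near. Qed.

Lemma limsup_le0_norm x : limsup_le0 (fun t => `|x t|) -> limsup_le0 x.
Proof. by apply: limsup_le0_le; near=> t; exact: ler_norm. 
Unshelve. all: by end_near. Qed.

Lemma limsup_le0_cvg x (l : R) : limsup_le0 (fun t => x t - l) ->
  limsup_le0 (fun t => l - x t) -> x @ \oo --> l.
Proof.
move=> h1 h2; apply/cvgrPdist_le => e e0; near=> t.
rewrite ler_norml; apply/andP; split; last by near: t; exact: h2.
by rewrite lerNl opprB; near: t; exact: h1.
Unshelve. all: by end_near. Qed.

End LimsupAlgebra.

(** * Maximum principle and optimal policies *)

Section MaximumPrinciple.
Context (R : realType) (n : nat).
Implicit Types (B : 'M[R]_n) (x y g : 'cV[R]_n).

(** Satisfied by the substochastic matrix of a policy exactly when its chain is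
    absorbed from every state. *)
Definition max_principle B : Prop :=
  forall x, (forall i, x i 0 <= (B *m x) i 0) -> forall i, x i 0 <= 0.

(** The fixed point of x |-> g + B x; it is the total expected cost when g is the
    stage cost vector, and the expected absorption time when g is constantly 1. *)
Definition solve B g : 'cV[R]_n := invmx (1%:M - B) *m g.

(** A vector fixed by B is at most 0, and so is its opposite. *)
Lemma max_principle_unit B : max_principle B -> 1%:M - B \in unitmx.
Proof.
move=> mp; rewrite -unitmx_tr unitmxE unitfE; apply/det0P => -[v v0 hv].
have e : B *m v^T = v^T.
  have := congr1 trmx hv; rewrite trmx_mul trmxK trmx0 mulmxBl mul1mx.
  by move/eqP; rewrite subr_eq0 => /eqP <-.
have le1 := mp v^T; have le2 := mp (- v^T).
case/eqP: v0; apply/rowP => j; rewrite mxE; apply/eqP; rewrite eq_le.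
apply/andP; split.
  by have := le1 _ j; rewrite mxE; apply=> i; rewrite e.
have := le2 _ j; rewrite !mxE oppr_le0; apply => i.
by rewrite mulmxN e.
Qed.

Lemma solveE B g : max_principle B -> solve B g = g + B *m solve B g.
Proof.
move=> /max_principle_unit u; rewrite {1}/solve.
have : (1%:M - B) *m solve B g = g by rewrite /solve mulKVmx.
by rewrite mulmxBl mul1mx => /eqP; rewrite subr_eq => /eqP.
Qed.

Lemma le_solve B g x : max_principle B ->
  (forall i, x i 0 <= g i 0 + (B *m x) i 0) -> forall i, x i 0 <= solve B g i 0.
Proof.
move=> mp h i; rewrite -subr_le0.
have := mp (x - solve B g) _ i; rewrite !mxE; apply => j.
rewrite mulmxBr [in leLHS](solveE g mp) !mxE.
have := h j; rewrite !mxE; lra.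
Qed.

Lemma ge_solve B g x : max_principle B ->
  (forall i, g i 0 + (B *m x) i 0 <= x i 0) -> forall i, solve B g i 0 <= x i 0.
Proof.
move=> mp h i; rewrite -subr_le0.
have := mp (solve B g - x) _ i; rewrite !mxE; apply => j.
rewrite mulmxBr [in leLHS](solveE g mp) !mxE.
have := h j; rewrite !mxE; lra.
Qed.

Lemma solveZ B c g : solve B (c *: g) = c *: solve B g.
Proof. by rewrite /solve scalemxAr. Qed.

Lemma solve_ge0 B g : max_principle B -> (forall i, 0 <= g i 0) ->
  forall i, 0 <= solve B g i 0.
Proof.
move=> mp g0 i; apply: (@le_trans _ _ ((0 : 'cV[R]_n) i 0)).
  by rewrite mxE.
by apply: le_solve => // j; rewrite mulmx0 !mxE addr0.
Qed.

Lemma solve1_ge1 B : max_principle B -> (forall i j, 0 <= B i j) ->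
  forall i, 1 <= solve B (const_mx 1) i 0.
Proof.
move=> mp B0 i; rewrite solveE // [leRHS]mxE [X in _ <= X + _]mxE lerDl mxE.
apply: sumr_ge0 => j _; rewrite mulr_ge0 // solve_ge0 // => k.
by rewrite mxE.
Qed.

End MaximumPrinciple.

Section Policies.
Context (R : realType) (n : nat) (A : finType) (M : ssp R n A).
Hypothesis mp : forall mu, max_principle (trans_mx M mu).

Definition policy_cost (mu : policy n A) : 'cV[R]_n :=
  solve (trans_mx M mu) (cost_vec M mu).

Lemma TpolE (mu : policy n A) (J : 'cV[R]_n) i :
  Tpol M mu J i 0 = cost M i (mu i) + \sum_j trans M i (mu i) j * J j 0.
Proof. by rewrite !mxE; congr (_ + _); apply: eq_bigr => j _; rewrite mxE. Qed.

Lemma policy_cost_fixed (mu : policy n A) :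
  Tpol M mu (policy_cost mu) = policy_cost mu.
Proof. by rewrite [in RHS]/policy_cost solveE. Qed.

Lemma Topt_le_Tpol (nu : policy n A) (J : 'cV[R]_n) i :
  Topt M J i 0 <= Tpol M nu J i 0.
Proof.
rewrite TpolE mxE.
exact: (finmin_attained
  (fun a => cost M i a + \sum_j trans M i a j * J j 0) (nu i)).2.
Qed.

(** Policy improvement: if some action at some state improved on the policy
    minimising the sum of the costs, switching to it would lower the cost of
    that state and raise none, hence lower the sum.  So the minimiser satisfies
    the Bellman inequality, and comparison with any other policy follows. *)
Lemma optimal_policy (mu0 : policy n A) :
  exists mu, forall nu i, policy_cost mu i 0 <= policy_cost nu i 0.
Proof.
have [mu _ hmu] := @arg_minP _ _ _ mu0 xpredT
  (fun mu => \sum_i policy_cost mu i 0) erefl.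
exists mu => nu.
set J := policy_cost mu.
suff H : forall i a, J i 0 <= cost M i a + \sum_j trans M i a j * J j 0.
  apply: (@le_solve _ _ (trans_mx M nu) (cost_vec M nu)) => [|i]; first exact: mp.
  by have := H i (nu i); rewrite -TpolE [leRHS]mxE.
move=> i a; rewrite leNgt; apply/negP => lt.
pose mu' : policy n A := [ffun k => if k == i then a else mu k].
have le k : Tpol M mu' J k 0 <= J k 0.
  rewrite TpolE ffunE; case: eqP => [->|_]; first exact: ltW.
  by rewrite -TpolE policy_cost_fixed.
have le' k : policy_cost mu' k 0 <= J k 0.
  move: k; apply: (@ge_solve _ _ (trans_mx M mu') (cost_vec M mu')) => [|k']; first exact: mp.
  by have := le k'; rewrite [leLHS]mxE.
have lti : policy_cost mu' i 0 < J i 0.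
  apply: le_lt_trans lt; rewrite -(policy_cost_fixed mu') TpolE ffunE eqxx.
  rewrite lerD2l; apply: ler_sum => j _; rewrite ler_wpM2l ?trans_ge0 //.
have := hmu mu' erefl; rewrite leNgt => /negP; apply.
rewrite [ltLHS](bigD1 i) //= [ltRHS](bigD1 i) //=; apply: ltr_leD => //.
by apply: ler_sum.
Qed.

End Policies.

(** * The absorbed Markov chain of a proper policy *)

Lemma big_option (V : Type) (idx : V) (op : Monoid.com_law idx) (I : finType)
  (F : option I -> V) :
  \big[op/idx]_x F x = op (F None) (\big[op/idx]_i F (Some i)).
Proof.
rewrite (bigD1 None) //=; congr (op _ _).
rewrite (reindex_omap Some id) //=; last by case.
by apply: eq_bigl => i; rewrite eqxx.
Qed.

Section FiniteValued.
Context (R : realType) (d : measure_display) (X : measurableType d).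
Variable Q : probability X R.

Lemma measurable_fin_preimage (I : finType) (f : X -> I) :
  (forall z, measurable (f @^-1` [set z])) -> forall B, measurable (f @^-1` B).
Proof.
move=> mf B.
rewrite (_ : f @^-1` B = \bigcup_(z in B) f @^-1` [set z]).
  by apply: fin_bigcup_measurable => // z _; exact: mf.
by apply/seteqP; split=> v /=; [exists (f v) | move=> [z Bz /= ->]].
Qed.

Lemma measure_fin_partition (I : finType) (f : X -> I) (E : set X) :
  (forall z, measurable (f @^-1` [set z])) -> measurable E ->
  Q E = (\sum_z Q (E `&` f @^-1` [set z]))%E.
Proof.
move=> mf mE.
have mz z : measurable (E `&` f @^-1` [set z]) by exact: measurableI.
have := integral_indic Q (measurableT) mE; rewrite setIT => <-.
under eq_integral.
  move=> v _.
  rewrite (_ : (\1_E v)%:E = \sum_z (\1_(E `&` f @^-1` [set z]) v)%:E)%E.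
    over.
  rewrite (bigD1 (f v)) //= big1 ?adde0 => [|z zf].
    rewrite !indicE in_setI [X in _ && X](_ : _ = true) ?andbT //.
    exact: mem_set.
  rewrite indicE; case: (boolP (_ \in _)) => //; rewrite inE /= => -[_ fz].
  by rewrite fz eqxx in zf.
rewrite ge0_integral_sum //.
  by apply: eq_bigr => z _; rewrite integral_indic // setIT.
 by move=> z; apply/measurable_EFinP; exact: measurable_indic.
Qed.

Lemma integral_fin_valued (I : finType) (f : X -> I) (h : I -> R) :
  (forall z, measurable (f @^-1` [set z])) ->
  Q.-integrable setT (fun v => (h (f v))%:E) /\
  (\int[Q]_v (h (f v))%:E = (\sum_z h z * fine (Q (f @^-1` [set z])))%:E)%E.
Proof.
move=> mf.
have iz z : Q.-integrable setT
    (fun v => ((h z)%:E * (\1_(f @^-1` [set z]) v)%:E)%E).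
  apply: integrableZl => //; exact: integrable_indic.
have E : (fun v => (h (f v))%:E) =
    (fun v => \sum_z ((h z)%:E * (\1_(f @^-1` [set z]) v)%:E)%E)%E.
  apply/funext => v; rewrite (bigD1 (f v)) //= big1 ?adde0 => [|z zf].
    by rewrite indicE mem_set // mule1.
  rewrite indicE memNset ?mule0 //= => fz; by rewrite fz eqxx in zf.
rewrite E; split; first exact: integrable_sum.
rewrite integral_sum // -sumEFin; apply: eq_bigr => z _.
rewrite integralZl //; last exact: integrable_indic.
by rewrite integral_indic // setIT EFinM fineK // fin_num_measure.
Qed.

End FiniteValued.

Section Chain.
Context (R : realType) (n : nat) (A : finType) (M : ssp R n A).
Context (d : measure_display) (X : measurableType d).
Variables (mu : policy n A) (i0 : 'I_n).
Variables (Q : probability X R) (s : nat -> X -> option 'I_n).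
Hypothesis traj : is_trajectory M mu i0 Q s.

Let ms t x : measurable (s t @^-1` [set x]).
Proof. by have [+ _ _] := traj; apply. Qed.

Definition window (k t : nat) (x : nat -> option 'I_n) : set X :=
  [set v | forall l, (k <= l <= t)%N -> s l v = x l].

Lemma measurable_window k t x : measurable (window k t x).
Proof.
rewrite (_ : window k t x =
    \bigcap_(l in [set l | (k <= l <= t)%N]) s l @^-1` [set x l]).
  by apply: bigcap_measurableType => l _; exact: ms.
by apply/seteqP; split=> v /= h l; exact: h.
Qed.

(** The Markov property given the whole history, which is the case k = 0, is
    summed over the values of s_0, ..., s_(k-1), one coordinate at a time. *)
Lemma window_markov k t x y : (k <= t)%N ->
  Q (window k t x `&` s t.+1 @^-1` [set y]) =
  (Q (window k t x) * (step_prob M mu (x t) y)%:E)%E.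
Proof.
elim: k x => [|k IH] x kt.
  have [_ _ /(_ t x y)] := traj.
  have -> : [set v | forall k, (k <= t)%N -> s k v = x k] = window 0 t x.
    by apply/seteqP; split=> v.
  move=> <-; congr (Q _); apply/seteqP; split=> v //=.
pose xz z l := if l == k then z else x l.
have split_window z : window k.+1 t x `&` s k @^-1` [set z] = window k t (xz z).
  apply/seteqP; split=> v /=.
    move=> [h hz] l; rewrite leq_eqVlt /xz => /andP[/predU1P[<-|kl] lt].
      by rewrite eqxx.
    by rewrite gtn_eqF // h // kl lt.
  move=> h; split.
    by move=> l /andP[kl lt]; rewrite h ?(ltnW kl) // /xz gtn_eqF.
  by rewrite h ?leqnn ?(ltnW kt) // /xz eqxx.
have mw := measurable_window k.+1 t x.
rewrite (measure_fin_partition Q (ms k) mw).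
rewrite (measure_fin_partition Q (ms k) (measurableI _ _ mw (ms t.+1 y))).
rewrite ge0_sume_distrl //; apply: eq_bigr => z _.
rewrite setIAC split_window IH 1?ltnW //.
by rewrite /xz gtn_eqF.
Qed.

Definition occupation (t : nat) (j : 'I_n) : R := fine (Q (s t @^-1` [set Some j])).

Lemma occupation_ge0 t j : 0 <= occupation t j.
Proof. by rewrite fine_ge0. Qed.

Lemma step_law t y : Q (s t.+1 @^-1` [set y]) =
  (\sum_x Q (s t @^-1` [set x]) * (step_prob M mu x y)%:E)%E.
Proof.
rewrite (measure_fin_partition Q (ms t) (ms t.+1 y)); apply: eq_bigr => x _.
have -> : s t @^-1` [set x] = window t t (fun=> x).
  apply/seteqP; split=> v /=; last by apply; rewrite leqnn.
  by move=> h l; rewrite -eqn_leq => /eqP <-.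
by rewrite setIC window_markov.
Qed.

Lemma occupation0 j : occupation 0 j = (j == i0)%:R.
Proof.
have [_ h0 _] := traj; rewrite /occupation.
have h0' : Q (s 0%N @^-1` [set Some i0]) = 1%E by rewrite -h0.
case: eqP => [->|ji]; first by rewrite h0'.
have : (Q (s 0%N @^-1` [set Some j]) <= Q (~` (s 0%N @^-1` [set Some i0])))%E.
  apply: le_measure; rewrite ?inE //; first exact: measurableC.
  by move=> v /= ->; case.
rewrite probability_setC // h0'.
by rewrite subee // measure_le0 => /eqP ->.
Qed.

Lemma occupationS t j : occupation t.+1 j =
  \sum_k occupation t k * trans M k (mu k) j.
Proof.
rewrite /occupation step_law big_option /= mule0 add0e.
rewrite -sum_fine => [|k _]; last by rewrite fin_numM ?fin_num_measure.
by apply: eq_bigr => k _; rewrite fineM // fin_num_measure.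
Qed.

Hypothesis proper : Q [set v | exists t, s t v = None] = 1%E.

Definition escape : set X :=
  \bigcup_t (s t @^-1` [set None] `&` ~` (s t.+1 @^-1` [set None])).

Lemma escape_null : measurable escape /\ Q escape = 0%E.
Proof.
have mt t : measurable (s t @^-1` [set None] `&` ~` (s t.+1 @^-1` [set None])).
  by apply: measurableI => //; exact: measurableC.
have mE : measurable escape by exact: bigcup_measurable.
split=> //; apply/negligibleP => //.
apply: negligible_bigcup => t; apply/negligibleP => //.
apply: etrans (measure_fin_partition Q (ms t.+1) (mt t)) _.
apply: big1 => -[j|] _.
  apply/eqP; rewrite -measure_le0.
  apply: le_trans (_ : Q (window t t (fun=> None) `&` s t.+1 @^-1` [set Some j]) <= _)%E.
    apply: le_measure; rewrite ?inE.
    - by apply: measurableI.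
    - by apply: measurableI => //; exact: measurable_window.
    move=> v /= [[sN _] ->]; split=> // l; by rewrite -eqn_leq => /eqP <-.
  by rewrite window_markov //= mule0.
by rewrite -setIA setICl setI0 measure0.
Qed.

Lemma absorbed_stays v : ~ escape v -> forall t k, s t v = None -> s (t + k)%N v = None.
Proof.
move=> nv t k st; elim: k => [|k IH]; first by rewrite addn0.
rewrite addnS; case E : (s (t + k).+1 v) => [j|//]; exfalso; apply: nv.
by exists (t + k)%N => //; split => //=; rewrite E.
Qed.

Lemma occupation_sum t :
  \sum_j occupation t j = fine (Q (~` (s t @^-1` [set None]))).
Proof.
have mC : measurable (~` (s t @^-1` [set None])) by exact: measurableC.
rewrite (measure_fin_partition Q (ms t) mC) big_option /= setICl measure0 add0e.
rewrite -sum_fine => [|k _]; last by rewrite fin_num_measure //; exact: measurableI.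
apply: eq_bigr => j _; congr (fine (Q _)).
by apply/seteqP; split => v /=; [move=> ->|case].
Qed.

(** Up to the null event of paths that leave the terminal state, the events
    that the chain is absorbed at time t increase to an event of probability 1. *)
Lemma occupation_cvg0 j : (fun t => occupation t j) @ \oo --> (0 : R).
Proof.
have [mE E0] := escape_null.
pose B t := s t @^-1` [set None] `|` escape.
have mB t : measurable (B t) by exact: measurableU.
have mUB : measurable (\bigcup_t B t) by exact: bigcup_measurable.
have ndB : nondecreasing_seq B.
  move=> a b ab; apply/subsetPset => v [av|ev]; last by right.
  have [ev|nv] := pselect (escape v); first by right.
  by left; rewrite /= -(subnKC ab); exact: absorbed_stays.
have cB := nondecreasing_cvg_mu mB mUB ndB (mu := Q).
have UB1 : Q (\bigcup_t B t) = 1%E.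
  apply/eqP; rewrite eq_le probability_le1 //=.
  rewrite -[leLHS]proper; apply: le_measure; rewrite ?inE //.
    rewrite (_ : [set v | _] = \bigcup_t s t @^-1` [set None]).
      exact: bigcup_measurable.
    by apply/seteqP; split=> v /= [t]; exists t.
  by move=> v [t st]; exists t => //; left.
have QB t : Q (B t) = Q (s t @^-1` [set None]).
  by rewrite measureU0.
have {}cB : (fun t => Q (B t)) @ \oo --> 1%E by rewrite -UB1; exact: cB.
have c1 : (fun t => fine (Q (s t @^-1` [set None]))) @ \oo --> (1 : R).
  apply/fine_cvg; apply: cvg_trans cB; apply: near_eq_cvg.
  by near=> t; rewrite /= QB.
have c0 : (fun t => 1 - fine (Q (s t @^-1` [set None]))) @ \oo --> (0 : R).
  rewrite -[X in _ --> X](subrr (1 : R)); apply: cvgB => //; exact: cvg_cst.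
apply: (squeeze_cvgr _ (cvg_cst 0) c0).
near=> t; rewrite occupation_ge0 /=.
apply: (@le_trans _ _ (\sum_j occupation t j)).
  by rewrite (bigD1 j) //= lerDl; apply: sumr_ge0 => k _; exact: occupation_ge0.
rewrite occupation_sum probability_setC // fineB ?fin_num_measure //.
Unshelve. all: by end_near. Qed.

Lemma occupation_pairing (x : 'cV[R]_n) t :
  \sum_j occupation t.+1 j * x j 0 =
  \sum_j occupation t j * (trans_mx M mu *m x) j 0.
Proof.
under eq_bigr do rewrite occupationS mulr_suml.
rewrite exchange_big; apply: eq_bigr => k _ /=.
by rewrite mxE mulr_sumr; apply: eq_bigr => j _; rewrite mxE mulrA.
Qed.

Lemma occupation_pairing0 (x : 'cV[R]_n) :
  \sum_j occupation 0 j * x j 0 = x i0 0.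
Proof.
rewrite (bigD1 i0) //= occupation0 eqxx mul1r big1 ?addr0 // => j ji.
by rewrite occupation0 (negbTE ji) mul0r.
Qed.

Lemma occupation_pairing_cvg0 (x : 'cV[R]_n) :
  (fun t => \sum_j occupation t j * x j 0) @ \oo --> (0 : R).
Proof.
rewrite -[X in _ --> X](_ : \sum_(j < n) 0 * x j 0 = 0); last first.
  by apply: big1 => j _; rewrite mul0r.
apply: cvg_big => [|j _]; first exact: add_continuous.
by apply: cvgM; [exact: occupation_cvg0|exact: cvg_cst].
Qed.

(** The pairing of x with the law at time t starts at x(i0), does not decrease,
    and tends to 0. *)
Lemma subharmonic_le0 (x : 'cV[R]_n) :
  (forall i, x i 0 <= (trans_mx M mu *m x) i 0) -> x i0 0 <= 0.
Proof.
move=> xP.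
have h t : x i0 0 <= \sum_j occupation t j * x j 0.
  elim: t => [|t IH]; first by rewrite occupation_pairing0.
  rewrite occupation_pairing; apply: le_trans IH _.
  by apply: ler_sum => j _; rewrite ler_wpM2l ?occupation_ge0.
have c := @occupation_pairing_cvg0 x.
rewrite -(cvg_lim _ c) //; apply: limr_ge; last by near=> t.
by apply/cvg_ex; exists 0.
Unshelve. all: by end_near. Qed.

End Chain.

(** * The expected total cost *)

Section MeasurableLimit.
Context (R : realType) (d : measure_display) (X : measurableType d).

(** By the Cauchy criterion with the tolerances 1 / (q + 1). *)
Lemma measurable_cvgn_set (S : nat -> X -> R) :
  (forall N, measurable_fun setT (S N)) ->
  measurable [set v | cvgn (fun N => S N v)].
Proof.
move=> mS.
rewrite (_ : [set v | _] = \bigcap_q \bigcup_m \bigcap_k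
    [set v | `|S (m + k)%N v - S m v| < q.+1%:R^-1]).
  apply: bigcap_measurableType => q _; apply: bigcup_measurable => m _.
  apply: bigcap_measurableType => k _.
  rewrite -[X in measurable X]setTI.
  apply: (@measurable_fun_ltr _ _ _ setT (fun v => `|S (m + k)%N v - S m v|)
    (cst q.+1%:R^-1)) => //.
  apply: (measurableT_comp (@normr_measurable R setT)).
  exact: measurable_funB.
apply/seteqP; split=> v /=.
  move=> /cvg_ex[/= l cl] q _.
  have q0 : (0 : R) < q.+1%:R^-1 / 2 by rewrite divr_gt0.
  have /cvgrPdist_lt /(_ _ q0) [m _ hm] := cl.
  exists m => // k _ /=.
  have h1 := hm m (leqnn m); have h2 := hm (m + k)%N (leq_addr k m).
  rewrite [ltRHS]splitr.
  by apply: le_lt_trans (ler_distD l _ _) _; rewrite ltrD // distrC.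
move=> h; apply: cvgn_small_tails => q.
by have [m _ hm] := h q I; exists m => k; exact: hm.
Qed.

(** The limit operator returns a fixed value on the paths without limit, so it is
    an everywhere limit of functions modified on a measurable set.  Without
    this, the expected total cost would be the integral of a function not known
    to be measurable. *)
Lemma measurable_limn (S : nat -> X -> R) :
  (forall N, measurable_fun setT (S N)) ->
  measurable_fun setT (fun v => limn (fun N => S N v)).
Proof.
move=> mS; pose C := [set v | cvgn (fun N => S N v)].
have mC : measurable C by exact: measurable_cvgn_set.
pose h N v := S N v * \1_C v + (point : R) * \1_(~` C) v.
have hm := @measurable_fun_cvg _ _ R setT h (fun v => limn (fun N => S N v)).
apply: hm.
  move=> N; apply: measurable_funD; apply: measurable_funM.
  - exact: mS.
  - exact: measurable_indic.
  - exact: measurable_cst.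
  - by apply: measurable_indic; exact: measurableC.
move=> v _; rewrite /h !indicE in_setC; case: (boolP (v \in C)) => /= vC.
  rewrite mulr0; under eq_fun do rewrite mulr1 addr0.
  by move: vC; rewrite inE.
rewrite mulr1; under eq_fun do rewrite mulr0 add0r.
rewrite dvgP; first exact: cvg_cst.
by move=> cv; move/negP: vC; apply; rewrite inE.
Qed.

End MeasurableLimit.

Section CostToGo.
Context (R : realType) (n : nat) (A : finType) (M : ssp R n A).
Context (d : measure_display) (X : measurableType d).
Variables (mu : policy n A) (i0 : 'I_n).
Variables (Q : probability X R) (s : nat -> X -> option 'I_n).
Hypothesis traj : is_trajectory M mu i0 Q s.
Hypothesis proper : Q [set v | exists t, s t v = None] = 1%E.
Hypothesis mp : max_principle (trans_mx M mu).

Let ms t x : measurable (s t @^-1` [set x]).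
Proof. by have [+ _ _] := traj; apply. Qed.

Let occ := occupation Q s.

(** Telescoping, since g = J - P J for the solution J. *)
Lemma occupation_series (g : 'cV[R]_n) N :
  \sum_(0 <= t < N) \sum_j occ t j * g j 0 =
  solve (trans_mx M mu) g i0 0 -
  \sum_j occ N j * solve (trans_mx M mu) g j 0.
Proof.
set J := solve _ g.
elim: N => [|N IH]; first by rewrite big_geq // (occupation_pairing0 traj) subrr.
rewrite big_nat_recr //= IH (occupation_pairing traj).
have -> : \sum_j occ N j * g j 0 =
    \sum_j occ N j * J j 0 - \sum_j occ N j * (trans_mx M mu *m J) j 0.
  rewrite -sumrB; apply: eq_bigr => j _; rewrite -mulrBr; congr (_ * _).
  by rewrite {1}/J solveE // -/J [in RHS]mxE addrK.
ring.
Qed.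

Lemma integral_stage (h : option 'I_n -> R) t : h None = 0 ->
  Q.-integrable setT (fun v => (h (s t v))%:E) /\
  (\int[Q]_v (h (s t v))%:E = (\sum_j occ t j * h (Some j))%:E)%E.
Proof.
move=> h0; have [i1 ->] := integral_fin_valued Q h (ms t); split => //.
rewrite big_option /= h0 mul0r add0r; congr EFin.
by apply: eq_bigr => j _; rewrite mulrC.
Qed.

(** Almost every path is eventually absorbed, so its partial costs are eventually
    constant.  Dominated convergence applies with the series of absolute costs,
    whose expectation is bounded by the solution for the absolute costs. *)
Lemma expected_total_cost :
  (\int[Q]_v (total_cost M s mu v)%:E = (policy_cost M mu i0 0)%:E)%E.
Proof.
pose S N v := \sum_(0 <= t < N) stage_cost M mu (s t v).
have istage t := integral_stage (h := stage_cost M mu) t erefl.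
pose habs x := `|stage_cost M mu x|.
have iabs t : _ := integral_stage (h := habs) t (normr0 R).
have mstage t : measurable_fun setT (fun v => stage_cost M mu (s t v)).
  exact/measurable_EFinP/(measurable_int Q)/(istage t).1.
have mS N : measurable_fun setT (S N) by exact: measurable_sum.
have mtot : measurable_fun setT (total_cost M s mu) by exact: measurable_limn.
pose G v := (\sum_(0 <= t <oo) (habs (s t v))%:E)%E.
have G0 t v : (0 <= (habs (s t v))%:E)%E by rewrite lee_fin /habs.
have mhabs t : measurable_fun setT (fun v => (habs (s t v))%:E).
  exact: (measurable_int Q (iabs t).1).
have mG : measurable_fun setT G.
  by apply: ge0_emeasurable_sum.
have iG : Q.-integrable setT G.
  apply/integrableP; split=> //.
  under eq_integral do rewrite gee0_abs ?nneseries_ge0 //.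
  rewrite integral_nneseries //.
  set gabs : 'cV[R]_n := \col_j habs (Some j).
  apply: (@le_lt_trans _ _ (solve (trans_mx M mu) gabs i0 0)%:E); last exact: ltry.
  apply: lime_le; first by apply: is_cvg_nneseries => t _ _; exact: integral_ge0.
  apply: nearW => N; under eq_bigr do rewrite (iabs _).2.
  rewrite sumEFin lee_fin.
  have -> : \sum_(0 <= t < N) \sum_j occ t j * habs (Some j) =
      \sum_(0 <= t < N) \sum_j occ t j * gabs j 0.
    by apply: eq_bigr => t _; apply: eq_bigr => j _; rewrite mxE.
  rewrite occupation_series lerBlDr lerDl; apply: sumr_ge0 => j _.
  rewrite mulr_ge0 ?occupation_ge0 //.
  by apply: solve_ge0 => // k; rewrite mxE /habs.
have ScvgT : {ae Q, forall v, setT v ->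
    (fun N => (S N v)%:E) @ \oo --> (total_cost M s mu v)%:E}.
  have [mE E0] := escape_null traj.
  have mN : measurable [set v | exists t, s t v = None].
    rewrite (_ : [set v | _] = \bigcup_t s t @^-1` [set None]).
      exact: bigcup_measurable.
    by apply/seteqP; split=> v /= [t]; exists t.
  exists (escape s `|` ~` [set v | exists t, s t v = None]); split.
  - by apply: measurableU => //; exact: measurableC.
  - apply: etrans (measureU0 mE (measurableC mN) _) E0.
    apply: etrans (probability_setC Q mN) _.
    by rewrite [X in (1 - X)%E](proper) subee.
  move=> v /= nv; apply: contrapT => h; apply: nv => _.
  move/not_orP: h => [nE /contrapT[t0 st0]].
  have St k : S (t0 + k)%N v = S t0 v.
    elim: k => [|k IH]; first by rewrite addn0.
    by rewrite addnS /S big_nat_recr //= -/(S _ _) IH (absorbed_stays nE k st0) addr0.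
  have Sc : (fun N => S N v) @ \oo --> S t0 v.
    apply: cvg_near_cst; exists t0 => // t /= tt; by rewrite -(subnKC tt) St.
  apply/cvg_EFin; first by near=> t.
  by rewrite /total_cost (cvg_lim _ Sc).
have domi : {ae Q, forall v N, setT v -> (`|(S N v)%:E| <= G v)%E}.
  apply: aeW => v N _; apply: le_trans (_ : (\sum_(0 <= t < N) (habs (s t v))%:E <= _)%E).
    by rewrite sumEFin lee_fin; exact: ler_norm_sum.
  exact: nneseries_lim_ge.
have [_ _ cS] := dominated_convergence (mu := Q) measurableT
  (fun N => (measurable_EFinP _ _).2 (mS N)) ((measurable_EFinP _ _).2 mtot)
  ScvgT iG domi.
have IS N : (\int[Q]_v (S N v)%:E = (policy_cost M mu i0 0 -
    \sum_j occ N j * policy_cost M mu j 0)%:E)%E.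
  rewrite -occupation_series -sumEFin.
  under eq_integral do rewrite -sumEFin.
  rewrite integral_sum // => [|t]; last exact: (istage t).1.
  apply: eq_bigr => t _; rewrite (istage t).2; congr EFin.
  by apply: eq_bigr => j _; rewrite mxE.
apply: (cvg_unique _ cS) => //=.
under eq_fun do rewrite IS.
apply/cvg_EFin; first by near=> t.
rewrite -[X in _ --> X]subr0; apply: cvgB; first exact: cvg_cst.
exact: (occupation_pairing_cvg0 traj proper).
Unshelve. all: by end_near. Qed.

End CostToGo.

(** * Deterministic convergence of the perturbed iteration *)

Lemma is_cvgn_fin_sum (R : realType) (I : finType) (f : I -> nat -> R) :
  (forall i, cvgn (f i)) -> cvgn (fun N => \sum_i f i N).
Proof.
move=> fc; rewrite /index_enum; elim: Finite.enum => [|i s IH].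
  by under eq_fun do rewrite big_nil; exact: is_cvg_cst.
have -> : (fun N => \sum_(j <- i :: s) f j N) =
    f i \+ (fun N => \sum_(j <- s) f j N).
  by apply/funext => N; rewrite big_cons.
exact: is_cvgD.
Qed.

Section Pathwise.
Context (R : realType) (n : nat) (A : finType) (M : ssp R n A).
Hypothesis mp : forall mu, max_principle (trans_mx M mu).
Variables (J : nat -> 'cV[R]_n) (mu : nat -> policy n A).
Variables (g : nat -> R) (dlt zt : nat -> 'I_n -> R).
Hypothesis g_ge0 : forall t, 0 <= g t.
Hypothesis g_le1 : \forall t \near \oo, g t <= 1.
Hypothesis g_div : divergent_sum g.
Hypothesis dlt0 : forall i, limsup_le0 (fun t => `|dlt t i|).
Hypothesis zt_cvg : forall i, cvgn (fun N => \sum_(0 <= t < N) zt t i).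
Hypothesis Pzt_cvg : forall i j,
  cvgn (fun N => \sum_(0 <= t < N) trans M i (mu t i) j * zt t j).
Hypothesis greedy : forall t nu i,
  Tpol M (mu t) (J t) i 0 <= Tpol M nu (J t) i 0.
Hypothesis Jrec : forall t i, J t.+1 i 0 = J t i 0 +
  g t * (policy_cost M (mu t) i 0 - J t i 0) + g t * dlt t i + zt t i.

Let trans_sum_le1 i a (x : 'I_n -> R) (c : R) : (forall j, x j <= c) -> 0 <= c ->
  \sum_j trans M i a j * x j <= c.
Proof.
move=> xc c0; apply: (@le_trans _ _ (\sum_j trans M i a j * c)).
  by apply: ler_sum => j _; rewrite ler_wpM2l ?trans_ge0.
by rewrite -mulr_suml -[leRHS]mul1r ler_wpM2r ?trans_le1.
Qed.

Let subE (x y : 'cV[R]_n) i : (x - y) i 0 = x i 0 - y i 0.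
Proof. by rewrite !mxE. Qed.

Let trans_mulE (nu : policy n A) (x : 'cV[R]_n) i :
  (trans_mx M nu *m x) i 0 = \sum_j trans M i (nu i) j * x j 0.
Proof. by rewrite mxE; apply: eq_bigr => j _; rewrite mxE. Qed.

Let norm_le_sum (x : 'I_n -> R) i : `|x i| <= \sum_j `|x j|.
Proof. by rewrite [leRHS](bigD1 i) //= lerDl; apply: sumr_ge0. Qed.

(** The greedy policy of time t still competes at time t + 1, which bounds the
    new gap by an affine function of J_(t+1), hence by the old gap shrunk by
    1 - g_t, plus noise. *)
Lemma bellman_gap_limsup i :
  limsup_le0 (fun t => Tpol M (mu t) (J t) i 0 - J t i 0).
Proof.
apply: (@averaging_limsup_le0 _ g _
  (fun t => \sum_j trans M i (mu t i) j * dlt t j - dlt t i)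
  (fun t => \sum_j trans M i (mu t i) j * zt t j - zt t i)) => //.
- apply: (@limsup_le0_le _ _ (fun t => \sum_j `|dlt t j| + `|dlt t i|)).
    near=> t; apply: lerD; last by rewrite -normrN ler_norm.
    apply: trans_sum_le1 => [j|]; last exact: sumr_ge0.
    exact: le_trans (ler_norm _) (norm_le_sum (dlt t) j).
  by apply: limsup_le0D => //; apply: limsup_le0_sum.
- have -> : (fun N => \sum_(0 <= t < N)
        (\sum_j trans M i (mu t i) j * zt t j - zt t i)) =
      (fun N => \sum_j (\sum_(0 <= t < N) trans M i (mu t i) j * zt t j))
      \- (fun N => \sum_(0 <= t < N) zt t i).
    by apply/funext => N; rewrite sumrB exchange_big.
  apply: is_cvgB => //.
  exact: is_cvgn_fin_sum.
near=> t.
(* Minimality of the new greedy policy, against the previous one. *)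
apply: (@le_trans _ _ (Tpol M (mu t) (J t.+1) i 0 - J t.+1 i 0)).
  by rewrite lerD2r greedy.
rewrite !TpolE Jrec.
have -> : \sum_j trans M i (mu t i) j * J t.+1 j 0 =
    (1 - g t) * (\sum_j trans M i (mu t i) j * J t j 0) +
    g t * (\sum_j trans M i (mu t i) j * policy_cost M (mu t) j 0) +
    g t * (\sum_j trans M i (mu t i) j * dlt t j) +
    \sum_j trans M i (mu t i) j * zt t j.
  rewrite !mulr_sumr -!big_split /=; apply: eq_bigr => j _; rewrite Jrec; ring.
have : policy_cost M (mu t) i 0 = cost M i (mu t i) +
   \sum_j trans M i (mu t i) j * policy_cost M (mu t) j 0.
  by rewrite -TpolE policy_cost_fixed.
move=> ->; lra.
Unshelve. all: by end_near. Qed.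

(** The difference y between the cost of the current policy and T J_t satisfies
    y <= P y + m where m bounds the gap; so y is at most m times the expected
    absorption time, which is bounded uniformly over the finitely many
    policies. *)
Lemma policy_cost_upper : exists2 r : nat -> R, limsup_le0 r &
  forall t nu i, policy_cost M (mu t) i 0 <= Tpol M nu (J t) i 0 + r t.
Proof.
pose X t i := Tpol M (mu t) (J t) i 0 - J t i 0.
pose m t := \sum_i Num.max (X t i) 0.
pose u nu := solve (trans_mx M nu) (const_mx 1).
pose K := \sum_(nu : policy n A) \sum_i `|u nu i 0|.
have m0 t : 0 <= m t by apply: sumr_ge0 => i _; rewrite le_max lexx orbT.
have uK nu i : u nu i 0 <= K.
  apply: le_trans (ler_norm _) _; rewrite /K (bigD1 nu) //=.
  apply: le_trans (norm_le_sum (fun i => u nu i 0) i) _.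
  by rewrite lerDl; apply: sumr_ge0 => nu' _; apply: sumr_ge0.
have Xm t i : X t i <= m t.
  rewrite /m (bigD1 i) //= -[leLHS]addr0; apply: lerD; rewrite ?le_max ?lexx //.
  by apply: sumr_ge0 => j _; rewrite le_max lexx orbT.
exists (fun t => K * m t).
  apply: limsup_le0_scale; first by do 2 apply: sumr_ge0 => ? _.
  by apply: limsup_le0_sum => i; apply/limsup_le0_max0/bellman_gap_limsup.
move=> t nu i.
apply: (@le_trans _ _ (Tpol M (mu t) (J t) i 0 + K * m t)); last first.
  by rewrite lerD2r greedy.
rewrite -lerBlDl.
pose y := policy_cost M (mu t) - Tpol M (mu t) (J t).
have ys : y i 0 <= solve (trans_mx M (mu t)) (m t *: const_mx 1) i 0.
  apply: (@le_solve _ _ (trans_mx M (mu t)) (m t *: const_mx 1)); first exact: mp.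
  move=> k; rewrite /y -[in leLHS](policy_cost_fixed mp).
  have -> : (Tpol M (mu t) (policy_cost M (mu t)) - Tpol M (mu t) (J t)) k 0 =
     \sum_j trans M k (mu t k) j * X t j +
     (trans_mx M (mu t) *m (policy_cost M (mu t) - Tpol M (mu t) (J t))) k 0.
    rewrite trans_mulE subE !TpolE opprD addrACA subrr add0r -sumrB -big_split.
    apply: eq_bigr => j _; rewrite /X subE /=; ring.
  rewrite lerD2r !mxE mulr1; apply: trans_sum_le1 => //.
have : y i 0 = policy_cost M (mu t) i 0 - Tpol M (mu t) (J t) i 0.
  by rewrite /y subE.
move=> <-; apply: le_trans ys _.
rewrite solveZ mxE mulrC ler_wpM2r //; exact: uK.
Qed.

Variable mustar : policy n A.
Hypothesis mustar_opt :
  forall nu i, policy_cost M mustar i 0 <= policy_cost M nu i 0.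

(** Every sampled cost is at least the optimal one. *)
Lemma iterates_lower i :
  limsup_le0 (fun t => policy_cost M mustar i 0 - J t i 0).
Proof.
apply: (@averaging_limsup_le0 _ g _ (fun t => - dlt t i) (fun t => - zt t i)) => //.
- by apply: limsup_le0_norm; under eq_fun do rewrite normrN; exact: dlt0.
- have -> : (fun N => \sum_(0 <= t < N) - zt t i) =
      \- (fun N => \sum_(0 <= t < N) zt t i).
    by apply/funext => N /=; rewrite sumrN.
  exact: is_cvgN.
near=> t; rewrite Jrec.
have := ler_wpM2l (g_ge0 t) (mustar_opt (mu t) i); lra.
Unshelve. all: by end_near. Qed.

(** The expected absorption time u of the optimal policy satisfies
    P u = u - 1 <= (1 - 1/U) u for any bound U on u, so P contracts the supremum
    norm weighted by 1/u.  The weighted maximum c_t of the positive part of the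
    noise-corrected error D_t then obeys a scalar averaging recursion with
    steps g_t / U. *)
Lemma iterates_upper i :
  limsup_le0 (fun t => J t i 0 - policy_cost M mustar i 0).
Proof.
have [r r0 hr] := policy_cost_upper.
set Js := policy_cost M mustar.
pose u := solve (trans_mx M mustar) (const_mx 1).
have u1 k : 1 <= u k 0.
  by apply: solve1_ge1 => // a b; rewrite mxE trans_ge0.
pose U := 1 + \sum_k u k 0.
have uU k : u k 0 <= U.
  rewrite /U (bigD1 k) //=.
  have : 0 <= \sum_(i0 | i0 != k) u i0 0.
    by apply: sumr_ge0 => j _; apply: le_trans (u1 j).
  lra.
have U1 : 1 <= U by apply: le_trans (u1 i) (uU i).
have uE k : \sum_j trans M k (mustar k) j * u j 0 = u k 0 - 1.
  rewrite [in RHS]/u solveE // -/u !mxE addrAC subrr add0r.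
  by apply: eq_bigr => j _; rewrite !mxE.
have lim_ex k : exists l, (fun N => \sum_(0 <= t < N) zt t k) @ \oo --> (l : R).
  by have /cvg_ex[/= l h] := @zt_cvg k; exists l.
have [l hl] := choice lim_ex.
pose Z t k := l k - \sum_(0 <= s < t) zt s k.
have Z0 k : limsup_le0 (fun t => `|Z t k|).
  by move=> e e0; exact: series_tail_vanishes.
(* The tail Z of the noise is absorbed in the error, so that D has no noise. *)
pose D t k := J t k 0 - Js k 0 + Z t k.
pose w t k := r t + `|dlt t k| + `|Z t k| + \sum_j `|Z t j|.
have w0 k : limsup_le0 (fun t => w t k).
  apply: limsup_le0D; last exact: limsup_le0_sum.
  by apply: limsup_le0D => //; apply: limsup_le0D.
pose rho t := \sum_k Num.max (w t k) 0.
have rho0 t : 0 <= rho t by apply: sumr_ge0 => k _; rewrite le_max lexx orbT.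
have wrho t k : w t k <= rho t.
  rewrite /rho (bigD1 k) //= -[leLHS]addr0; apply: lerD; rewrite ?le_max ?lexx //.
  by apply: sumr_ge0 => j _; rewrite le_max lexx orbT.
have rhol : limsup_le0 rho.
  by apply: limsup_le0_sum => k; exact: limsup_le0_max0.
have Drec t k : g t <= 1 -> D t.+1 k <= (1 - g t) * D t k +
    g t * (\sum_j trans M k (mustar k) j * D t j + rho t).
  move=> g1.
  have ZS : Z t.+1 k = Z t k - zt t k by rewrite /Z big_nat_recr //=; ring.
  have hJs : Js k 0 = cost M k (mustar k) + \sum_j trans M k (mustar k) j * Js j 0.
    by rewrite -TpolE policy_cost_fixed.
  have h1 := hr t mustar k; rewrite TpolE in h1.
  have e1 : \sum_j trans M k (mustar k) j * D t j =
     \sum_j trans M k (mustar k) j * J t j 0 -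
     \sum_j trans M k (mustar k) j * Js j 0 +
     \sum_j trans M k (mustar k) j * Z t j.
    rewrite -sumrB -big_split; apply: eq_bigr => j _; rewrite /D /=; ring.
  have h2 : - \sum_j trans M k (mustar k) j * Z t j <= \sum_j `|Z t j|.
    rewrite -sumrN; under eq_bigr do rewrite -mulrN.
    apply: trans_sum_le1 => [j|]; last exact: sumr_ge0.
    apply: le_trans (norm_le_sum (Z t) j); rewrite -normrN; exact: ler_norm.
  have h3 := wrho t k.
  have h4 : policy_cost M (mu t) k 0 - Js k 0 + dlt t k + Z t k <=
      \sum_j trans M k (mustar k) j * D t j + rho t.
    rewrite e1; rewrite /w in h3.
    have := ler_norm (dlt t k); have := ler_norm (Z t k); lra.
  rewrite {1}/D Jrec ZS.
  have := ler_wpM2l (g_ge0 t) h4; rewrite /D; lra.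
pose c t := \big[Num.max/0]_k (D t k / u k 0).
have u0 k : 0 < u k 0 by apply: lt_le_trans (u1 k).
have c0 t : 0 <= c t by exact: bigmax_ge_id.
have Dc t k : D t k <= c t * u k 0.
  by rewrite -ler_pdivrMr //; apply: (@le_bigmax _ _ _ 0 (fun k => D t k / u k 0)).
(* D_t <= c_t u, and one step maps the bound c u to (1 - g) c u + g c (u - 1). *)
have cl : limsup_le0 c.
  apply: (@averaging_limsup_le0 _ (fun t => g t / U) _ (fun t => U * rho t)
    (fun=> 0)).
  - by move=> t; rewrite divr_ge0 // (le_trans _ U1).
  - near=> t; rewrite ler_pdivrMr ?(lt_le_trans _ U1) // mul1r.
    by apply: le_trans U1; near: t.
  - move=> K; have [N hN] := g_div (K * U).
    by exists N; rewrite -mulr_suml ler_pdivlMr ?(lt_le_trans _ U1).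
  - by apply: limsup_le0_scale => //; apply: le_trans U1.
  - by under eq_fun do rewrite big1 //; exact: is_cvg_cst.
  near=> t.
  have g1 : g t <= 1 by near: t.
  have Upos : 0 < U by apply: lt_le_trans U1.
  have gU : g t / U <= 1 by rewrite ler_pdivrMr // mul1r (le_trans g1).
  have -> : g t / U * (U * rho t) = g t * rho t by field; rewrite gt_eqF.
  rewrite addr0; apply: bigmax_le => [|k _].
    by rewrite addr_ge0 ?mulr_ge0 ?subr_ge0.
  rewrite ler_pdivrMr //; apply: le_trans (Drec t k g1) _.
  have h1 : \sum_j trans M k (mustar k) j * D t j <= c t * (u k 0 - 1).
    rewrite -uE mulr_sumr; apply: ler_sum => j _.
    by rewrite mulrCA ler_wpM2l ?trans_ge0.
  have s0 : 0 <= 1 - g t by rewrite subr_ge0.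
  have h2 := ler_wpM2l s0 (Dc t k).
  have h3 : g t * (\sum_j trans M k (mustar k) j * D t j + rho t) <=
      g t * (c t * (u k 0 - 1) + rho t) by rewrite ler_wpM2l // lerD2r.
  have h4 : g t * rho t <= g t * rho t * u k 0 by rewrite ler_peMr // mulr_ge0.
  have h5 : g t / U * c t * u k 0 <= g t * c t.
    rewrite -mulrA mulrAC mulrCA -!mulrA; rewrite mulrA.
    have : u k 0 / U <= 1 by rewrite ler_pdivrMr // mul1r.
    have := mulr_ge0 (g_ge0 t) (c0 t) => gc h.
    have := ler_wpM2l gc h; lra.
  lra.
apply: (@limsup_le0_le _ _ (fun t => U * c t + `|Z t i|)).
  near=> t; have := Dc t i; rewrite /D.
  have := ler_wpM2l (c0 t) (uU i); have := ler_norm (- Z t i); rewrite normrN.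
  lra.
apply: limsup_le0D => //; apply: limsup_le0_scale => //; exact: le_trans U1.
Unshelve. all: by end_near. Qed.

Theorem iterates_cvg i : (fun t => J t i 0) @ \oo --> policy_cost M mustar i 0.
Proof. exact: limsup_le0_cvg (iterates_upper i) (iterates_lower i). Qed.

End Pathwise.

(** * Selection noise and simulation noise *)

Section GeneratedEvents.
Context (R : realType) (d : measure_display) (Omega : measurableType d).
Variable P : probability Omega R.

Lemma gen_measurable_comp (I : Type) (H : set (set Omega)) (f : Omega -> I)
    (h : I -> R) :
  (forall B : set I, <<s H >> (f @^-1` B)) -> gen_measurable H (h \o f).
Proof. by move=> Hf _ B mB; rewrite setTI; exact: (Hf (h @^-1` B)). Qed.

Lemma gen_measurable_self (H : set (set Omega)) (f : Omega -> R) :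
  (forall B : set R, measurable B -> <<s H >> (f @^-1` B)) -> gen_measurable H f.
Proof. by move=> Hf _ B mB; rewrite setTI; exact: Hf. Qed.

Lemma ae_bounded_integral (Y a : Omega -> R) (C : R) :
  P.-integrable setT (EFin \o Y) -> {ae P, forall v, Y v <= C} ->
  measurable_fun setT a -> (forall v, 0 <= a v) ->
  P.-integrable setT (EFin \o a) ->
  P.-integrable setT (fun v => (Y v * a v)%:E) ->
  \int[P]_v (Y v * a v) <= C * \int[P]_v a v.
Proof.
move=> iY YC ma a0 ia iYa.
have mY : measurable_fun setT Y by exact/measurable_EFinP/(measurable_int P).
rewrite -RintegralZl //.
pose Y' v := Num.min (Y v) C.
have mY' : measurable_fun setT Y'.
  by apply: measurable_minr => //; exact: measurable_cst.
have -> : \int[P]_v (Y v * a v) = \int[P]_v (Y' v * a v).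
  congr fine; apply: ae_eq_integral => //.
  - by apply/measurable_EFinP/measurable_funM.
  - by apply/measurable_EFinP/measurable_funM.
  by apply: filterS YC => v Yv _ /=; rewrite /Y' (min_idPl Yv).
have iCa : P.-integrable setT (fun v => (C * a v)%:E).
  by under eq_fun do rewrite EFinM; exact: integrableZl.
apply: le_Rintegral => //.
  apply: (@le_integrable _ _ _ P setT measurableT _
     (fun v => (`|Y v * a v|%:E + `|C * a v|%:E)%E)).
  - by apply/measurable_EFinP/measurable_funM.
  - move=> v _ /=; rewrite lee_fin [leRHS]ger0_norm ?addr_ge0 //.
    by rewrite /Y'; case: (ltP (Y v) C) => _; rewrite ?lerDl ?lerDr.
  - by apply: integrableD => //; exact: integrable_norm.
by move=> v _; rewrite ler_wpM2r // /Y' ge_min lexx orbT.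
Qed.

End GeneratedEvents.

Section Noise.
Context (R : realType) (n : nat) (A : finType).
Context (d : measure_display) (Omega : measurableType d).
Variables (P : probability Omega R) (J w : nat -> Omega -> 'cV[R]_n).
Variables (mu : nat -> Omega -> policy n A) (sel : nat -> Omega -> 'I_n).
Variables (p : 'I_n -> R) (C : R).
Hypothesis Jmeas : forall t i, measurable_fun setT (fun v => J t v i 0).
Hypothesis wmeas : forall t i, measurable_fun setT (fun v => w t v i 0).
Hypothesis mumeas : forall t m, measurable (mu t @^-1` [set m]).
Hypothesis selmeas : forall t i, measurable (sel t @^-1` [set i]).
Hypothesis hsel : forall t i, P (sel t @^-1` [set i]) = (p i)%:E.
Hypothesis hindep : forall t, independent_from P (sel t)
  (joined_with (natural_filtration J mu sel t) (w t)).
Hypothesis hw0 : forall t i, is_cond_exp P (natural_filtration J mu sel t)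
  (fun v => w t v i 0) (fun=> 0).
Hypothesis hw2 : forall t, exists2 Y : Omega -> R,
  is_cond_exp P (natural_filtration J mu sel t) (fun v => sqnorm (w t v)) Y
  & {ae P, forall v, Y v <= C}.

(** Generators of the natural filtration, which is by definition the
    sigma-algebra that they generate. *)
Definition past (t : nat) : set (set Omega) :=
  [set E | (exists2 k, (k <= t)%N & vec_events (J k) E)
        \/ (exists2 k, (k <= t)%N & fin_events (mu k) E)
        \/ (exists2 k, (k < t)%N & fin_events (sel k) E)].

(** Generators of the sigma-algebra from which the selection is independent. *)
Definition past_noise (t : nat) : set (set Omega) :=
  <<s past t >> `|` vec_events (w t).

Lemma past_measurable t : past t `<=` measurable.
Proof.
move=> E [[k _ [i [B [mB ->]]]]|[[k _ [B ->]]|[k _ [B ->]]]].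
- by rewrite -[X in measurable X]setTI; exact: Jmeas.
- exact: measurable_fin_preimage.
- exact: measurable_fin_preimage.
Qed.

Lemma past_mono t : past t `<=` <<s past t.+1 >>.
Proof.
move=> E h; apply: sub_sigma_algebra.
case: h => [[k kt h]|[[k kt h]|[k kt h]]].
- by left; exists k => //; exact: leqW.
- by right; left; exists k => //; exact: leqW.
- by right; right; exists k => //; exact: leqW.
Qed.

Lemma past_noise_measurable t : past_noise t `<=` measurable.
Proof.
move=> E [h|[i [B [mB ->]]]].
  exact: (smallest_sub (sigma_algebra_measurable _) (@past_measurable t) h).
by rewrite -[X in measurable X]setTI; exact: wmeas.
Qed.

Lemma past_sub_past_noise t (f : Omega -> R) : gen_measurable (past t) f ->
  gen_measurable (past_noise t) f.
Proof.
apply: gen_measurable_sub => E h; apply: sub_sigma_algebra; left.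
exact: sub_sigma_algebra.
Qed.

Lemma J_past k t i : (k <= t)%N -> gen_measurable (past t) (fun v => J k v i 0).
Proof.
move=> kt; apply: gen_measurable_self => B mB; apply: sub_sigma_algebra.
by left; exists k => //; exists i, B.
Qed.

Lemma mu_past k t (h : policy n A -> R) : (k <= t)%N ->
  gen_measurable (past t) (fun v => h (mu k v)).
Proof.
move=> kt; apply: gen_measurable_comp => B; apply: sub_sigma_algebra.
by right; left; exists k => //; exists B.
Qed.

Lemma sel_past k t (h : 'I_n -> R) : (k < t)%N ->
  gen_measurable (past t) (fun v => h (sel k v)).
Proof.
move=> kt; apply: gen_measurable_comp => B; apply: sub_sigma_algebra.
by right; right; exists k => //; exists B.
Qed.

Lemma w_past_noise t i : gen_measurable (past_noise t) (fun v => w t v i 0).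
Proof.
apply: gen_measurable_self => B mB; apply: sub_sigma_algebra.
by right; exists i, B.
Qed.

Definition chosen t i (v : Omega) : R := (sel t v == i)%:R.

Lemma chosenE t i : chosen t i = \1_(sel t @^-1` [set i]).
Proof.
apply/funext => v; rewrite /chosen indicE; case: eqP => [e|ne].
  by rewrite mem_set.
by rewrite memNset.
Qed.

Lemma chosen01 t i v : 0 <= chosen t i v <= 1.
Proof. by rewrite /chosen; case: (_ == _); rewrite lexx ler01. Qed.

Lemma chosen_past k t i : (k < t)%N -> gen_measurable (past t) (chosen k i).
Proof. exact: (@sel_past k t (fun j => (j == i)%:R)). Qed.

Lemma measurable_chosen t i : measurable_fun setT (chosen t i).
Proof. by rewrite chosenE; exact: measurable_indic. Qed.

Lemma sel_prob01 i : 0 <= p i <= 1.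
Proof.
have := hsel 0 i => h.
by rewrite -!lee_fin -h measure_ge0 probability_le1.
Qed.

Lemma chosen_dev_le1 t i v : `|chosen t i v - p i| <= 1.
Proof.
have /andP[c0 c1] := chosen01 t i v; have /andP[q0 q1] := sel_prob01 i.
by rewrite ler_norml; lra.
Qed.

Lemma measurable_chosen_dev t i :
  measurable_fun setT (fun v => chosen t i v - p i).
Proof. by apply: measurable_funB => //; exact: measurable_chosen. Qed.

Lemma integrable_bounded (f : Omega -> R) (b : R) : measurable_fun setT f ->
  (forall v, `|f v| <= b) -> P.-integrable setT (EFin \o f).
Proof.
move=> mf fb; apply: (@le_integrable _ _ _ P setT measurableT _ (cst b%:E)).
- exact/measurable_EFinP.
- by move=> v _ /=; rewrite lee_fin; apply: le_trans (fb v) (ler_norm _).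
- exact: finite_measure_integrable_cst.
Qed.

(** Independence says that the centred indicator of the selection integrates to
    0 on every event of the past joined with the current noise. *)
Lemma selection_orthogonal t i (Z : Omega -> R) :
  gen_measurable (past_noise t) Z -> P.-integrable setT (EFin \o Z) ->
  \int[P]_v ((chosen t i v - p i) * Z v) = 0.
Proof.
move=> mZ iZ.
have mZ' := gen_measurable_measurable (@past_noise_measurable t) mZ.
have mW := measurable_chosen_dev t i.
have bW := chosen_dev_le1 t i.
rewrite /Rintegral (@integral_test _ _ _ P (past_noise t)) //.
- exact: past_noise_measurable.
- exact: integrable_bounded mW bW.
- move=> E hE.
  have mE : measurable E.
    exact: (smallest_sub (sigma_algebra_measurable _)
      (@past_noise_measurable t) hE).
  under eq_integral do rewrite EFinB.
  have ich : P.-integrable E (fun v => (chosen t i v)%:E).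
    apply: (integrableS measurableT) => //; rewrite chosenE.
    exact: integrable_indic.
  rewrite integralB //; last first.
    apply: (integrableS measurableT) => //.
    exact: finite_measure_integrable_cst.
  rewrite integral_cst // chosenE integral_indic //.
  have pe : P (sel t @^-1` [set i] `&` E) = ((p i)%:E * P E)%E.
    by rewrite hindep // hsel.
  rewrite [X in (X - _)%E](_ : _ = ((p i)%:E * P E)%E); last exact: pe.
  by rewrite subee // fin_numM ?fin_num_measure.
- rewrite (_ : (fun v => _) = (fun v => (Z v * (chosen t i v - p i))%:E)).
    exact: integrable_bounded_mul bW.
  by apply/funext => v; rewrite mulrC.
Qed.

Lemma noise_integrable t i : P.-integrable setT (fun v => (w t v i 0)%:E).
Proof. by have [] := hw0 t i. Qed.

Lemma noise_orthogonal t i (Z : Omega -> R) (b : R) :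
  gen_measurable (past t) Z -> (forall v, `|Z v| <= b) ->
  \int[P]_v (w t v i 0 * Z v) = 0.
Proof.
move=> mZ bZ; rewrite /Rintegral (@integral_test _ _ _ P (past t)) //.
- exact: past_measurable.
- exact: noise_integrable.
- move=> E hE; have [_ _ _ ->] := hw0 t i => //.
  by rewrite integral0.
- apply: integrable_bounded_mul bZ; first exact: noise_integrable.
  exact: gen_measurable_measurable (@past_measurable t) mZ.
Qed.

(** The bound on the conditional second moment holds against indicators of past
    events, hence against squares of coefficients known at time t. *)
Lemma noise_sqr t i (a : Omega -> R) (b : R) :
  gen_measurable (past t) a -> (forall v, `|a v| <= b) ->
  P.-integrable setT (fun v => (w t v i 0 ^+ 2 * a v ^+ 2)%:E) /\
  \int[P]_v (w t v i 0 ^+ 2 * a v ^+ 2) <= `|C| * \int[P]_v (a v ^+ 2).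
Proof.
move=> ma ba.
have ma' := gen_measurable_measurable (@past_measurable t) ma.
have ma2 : gen_measurable (past t) (fun v => a v ^+ 2) by exact: measurable_funX.
have ma2' := gen_measurable_measurable (@past_measurable t) ma2.
have ba2 v : `|a v ^+ 2| <= b ^+ 2.
  rewrite normrX lerXn2r ?nnegrE //; exact: le_trans (ba v).
have [Y [is2 iY _ condY] YC] := hw2 t.
have ia2 := integrable_bounded ma2' ba2.
have iYa := integrable_bounded_mul iY ma2' ba2.
have isa := integrable_bounded_mul is2 ma2' ba2.
have iW : P.-integrable setT (EFin \o (fun v => sqnorm (w t v) - Y v)).
  rewrite (_ : _ \o _ = (fun v => (sqnorm (w t v))%:E - (Y v)%:E)%E).
    exact: integrableB.
  by apply/funext.
have e : \int[P]_v (sqnorm (w t v) * a v ^+ 2) = \int[P]_v (Y v * a v ^+ 2).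
  apply/eqP; rewrite -subr_eq0 -RintegralB //; apply/eqP.
  rewrite /Rintegral (_ : (fun v => _) = (fun v => ((sqnorm (w t v) - Y v) * a v ^+ 2)%:E)).
    rewrite (@integral_test _ _ _ P (past t)) //.
    - exact: past_measurable.
    - move=> E hE.
      have mE : measurable E.
        exact: (smallest_sub (sigma_algebra_measurable _) (@past_measurable t) hE).
      under eq_integral do rewrite EFinB.
      rewrite integralB //; try exact: (integrableS measurableT).
      rewrite condY // subee // integrable_fin_num //.
      exact: (integrableS measurableT).
    - exact: integrable_bounded_mul ba2.
  by apply/funext => v; rewrite mulrBl.
have wle v : w t v i 0 ^+ 2 <= sqnorm (w t v).
  rewrite /sqnorm (bigD1 i) //= lerDl; apply: sumr_ge0 => j _; exact: sqr_ge0.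
have i1 : P.-integrable setT (fun v => (w t v i 0 ^+ 2 * a v ^+ 2)%:E).
  apply: le_integrable isa => //.
    by apply/measurable_EFinP/measurable_funM => //; exact: measurable_funX.
  move=> v _ /=; have s0 := le_trans (sqr_ge0 _) (wle v).
  have a0 := sqr_ge0 (a v); have w0 := sqr_ge0 (w t v i 0).
  rewrite lee_fin !ger0_norm; [exact: ler_wpM2r|exact: mulr_ge0..].
split=> //.
apply: (@le_trans _ _ (\int[P]_v (sqnorm (w t v) * a v ^+ 2))).
  by apply: le_Rintegral => // v _; rewrite ler_wpM2r ?sqr_ge0.
rewrite e; apply: (@le_trans _ _ (C * \int[P]_v (a v ^+ 2))).
  by apply: ae_bounded_integral => // v; exact: sqr_ge0.
rewrite ler_wpM2r ?ler_norm //; apply: Rintegral_ge0 => v _; exact: sqr_ge0.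
Qed.

Section Series.
Variables (a : nat -> Omega -> R) (b V : R) (i : 'I_n).
Hypothesis a_past : forall t, gen_measurable (past t) (a t).
Hypothesis a_bounded : forall t v, `|a t v| <= b.
Hypothesis a_sqr : forall N, \sum_(0 <= t < N) \int[P]_v (a t v ^+ 2) <= V.

Let ma t : measurable_fun setT (a t).
Proof. exact: (gen_measurable_measurable (@past_measurable t) (@a_past t)). Qed.

Let a2_bounded t v : `|a t v ^+ 2| <= b ^+ 2.
Proof.
rewrite normrX lerXn2r ?nnegrE //; exact: le_trans (a_bounded t v).
Qed.

Let ia2 t : P.-integrable setT (fun v => (a t v ^+ 2)%:E).
Proof. exact: integrable_bounded (measurable_funX 2 (ma t)) (@a2_bounded t). Qed.

Lemma selection_series_cvg :
  {ae P, forall v, cvgn (fun N => \sum_(0 <= t < N) (chosen t i v - p i) * a t v)}.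
Proof.
have bW t := chosen_dev_le1 t i.
have mch t := measurable_chosen_dev t i.
have le2 t v : ((chosen t i v - p i) * a t v) ^+ 2 <= a t v ^+ 2.
  rewrite exprMn ler_piMl ?sqr_ge0 // -[leLHS]real_normK ?num_real //.
  by rewrite expr_le1.
have i2 t : P.-integrable setT (fun v => (((chosen t i v - p i) * a t v) ^+ 2)%:E).
  apply: le_integrable (ia2 t) => //.
    by apply/measurable_EFinP/measurable_funX/measurable_funM.
  by move=> v _ /=; rewrite lee_fin !ger0_norm ?sqr_ge0.
apply: (@martingale_series_cvg _ _ _ P past
  (fun t v => (chosen t i v - p i) * a t v) V).
- exact: past_measurable.
- exact: past_mono.
- move=> t; apply: measurable_funM; last exact: gen_measurable_sub (@past_mono t) (@a_past t).
  by apply: measurable_funB; [exact: chosen_past|exact: measurable_cst].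
- exact: i2.
- move=> t Z bZ mZ hZ.
  under eq_Rintegral do rewrite -mulrA.
  apply: selection_orthogonal.
    apply: past_sub_past_noise.
    exact: measurable_funM (@a_past t) mZ.
  have mZ' := gen_measurable_measurable (@past_measurable t) mZ.
  apply: (integrable_bounded (b := b * bZ)); first exact: measurable_funM.
  by move=> v; rewrite normrM ler_pM.
- move=> N; apply: le_trans (a_sqr N); apply: ler_sum => t _.
  by apply: le_Rintegral; [|exact: i2|exact: ia2|move=> v _; exact: le2].
Qed.

(** The noise of an unselected state is never revealed, so only its product with
    the selection and with a(t) can be known at time t + 1; this is a hypothesis,
    established where the product is recovered from the iterates. *)
Lemma noise_series_cvg :
  (forall t, gen_measurable (past t.+1) (fun v => chosen t i v * w t v i 0 * a t v)) ->
  {ae P, forall v, cvgn (fun N => \sum_(0 <= t < N) chosen t i v * w t v i 0 * a t v)}.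
Proof.
move=> adapted.
have le2 t v : (chosen t i v * w t v i 0 * a t v) ^+ 2 <= w t v i 0 ^+ 2 * a t v ^+ 2.
  have wa0 : 0 <= w t v i 0 ^+ 2 * a t v ^+ 2.
    exact: mulr_ge0 (sqr_ge0 _) (sqr_ge0 _).
  rewrite !exprMn -mulrA ler_piMl //.
  have /andP[c0 c1] := chosen01 t i v; exact: exprn_ile1.
have wa t := noise_sqr i (@a_past t) (@a_bounded t).
have i2 t : P.-integrable setT (fun v => ((chosen t i v * w t v i 0 * a t v) ^+ 2)%:E).
  apply: le_integrable (wa t).1 => //.
    apply/measurable_EFinP/measurable_funX.
    exact: gen_measurable_measurable (@past_measurable t.+1) (@adapted t).
  move=> v _ /=; rewrite lee_fin [leLHS]ger0_norm ?sqr_ge0 //.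
  exact: le_trans (le2 t v) (ler_norm _).
apply: (@martingale_series_cvg _ _ _ P past
  (fun t v => chosen t i v * w t v i 0 * a t v) (`|C| * V)).
- exact: past_measurable.
- exact: past_mono.
- exact: adapted.
- exact: i2.
- move=> t Z bZ mZ hZ.
  have maZ : gen_measurable (past t) (fun v => a t v * Z v) by exact: measurable_funM (@a_past t) mZ.
  have maZ' := gen_measurable_measurable (@past_measurable t) maZ.
  have baZ v : `|a t v * Z v| <= b * bZ by rewrite normrM ler_pM.
  have iwaZ : P.-integrable setT (fun v => (w t v i 0 * (a t v * Z v))%:E).
    exact: integrable_bounded_mul (noise_integrable t i) maZ' baZ.
  have iD : P.-integrable setT
      (fun v => ((chosen t i v - p i) * (w t v i 0 * (a t v * Z v)))%:E).
    have := integrable_bounded_mul iwaZ (measurable_chosen_dev t i)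
      (chosen_dev_le1 t i).
    by under eq_fun do rewrite mulrC.
  have -> : (fun v => chosen t i v * w t v i 0 * a t v * Z v) =
     (fun v => (chosen t i v - p i) * (w t v i 0 * (a t v * Z v)) +
        p i * (w t v i 0 * (a t v * Z v))).
    by apply/funext => v; ring.
  have ipw : P.-integrable setT (fun v => (p i * (w t v i 0 * (a t v * Z v)))%:E).
    by under eq_fun do rewrite EFinM; exact: integrableZl.
  rewrite RintegralD //.
  rewrite RintegralZl // (noise_orthogonal i maZ baZ) mulr0 addr0.
  apply: selection_orthogonal => //.
  apply: measurable_funM; first exact: w_past_noise.
  exact: past_sub_past_noise.
- move=> N; apply: (@le_trans _ _ (\sum_(0 <= t < N) (`|C| * \int[P]_v (a t v ^+ 2)))).
    apply: ler_sum => t _; apply: le_trans (wa t).2.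
    by apply: le_Rintegral; [|exact: i2|exact: (wa t).1|move=> v _; exact: le2].
  by rewrite -mulr_sumr ler_wpM2l.
Qed.

End Series.
End Noise.

(** * Almost sure convergence for general steps *)

Section Core.
Context (R : realType) (n : nat) (A : finType) (M : ssp R n A).
Hypothesis mp : forall m, max_principle (trans_mx M m).
Context (d : measure_display) (Omega : measurableType d).
Variables (P : probability Omega R) (J w : nat -> Omega -> 'cV[R]_n).
Variables (mu : nat -> Omega -> policy n A) (sel : nat -> Omega -> 'I_n).
Variables (p : 'I_n -> R) (C : R).
Hypothesis Jmeas : forall t i, measurable_fun setT (fun v => J t v i 0).
Hypothesis wmeas : forall t i, measurable_fun setT (fun v => w t v i 0).
Hypothesis mumeas : forall t m, measurable (mu t @^-1` [set m]).
Hypothesis selmeas : forall t i, measurable (sel t @^-1` [set i]).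
Hypothesis hsel : forall t i, P (sel t @^-1` [set i]) = (p i)%:E.
Hypothesis hindep : forall t, independent_from P (sel t)
  (joined_with (natural_filtration J mu sel t) (w t)).
Hypothesis hw0 : forall t i, is_cond_exp P (natural_filtration J mu sel t)
  (fun v => w t v i 0) (fun=> 0).
Hypothesis hw2 : forall t, exists2 Y : Omega -> R,
  is_cond_exp P (natural_filtration J mu sel t) (fun v => sqnorm (w t v)) Y
  & {ae P, forall v, Y v <= C}.

Local Notation past := (past J mu sel).

Variable c : nat -> Omega -> 'I_n -> R.
Variables (Kc : R) (V : 'I_n -> R).
Hypothesis c_past : forall t i, gen_measurable (past t) (fun v => c t v i).
Hypothesis c_ge0 : forall t v i, 0 <= c t v i.
Hypothesis c_le : forall t v i, c t v i <= Kc.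
Hypothesis c_near1 : \forall t \near \oo, forall v i, c t v i <= 1.
Hypothesis c_sqr : forall i N, \sum_(0 <= t < N) \int[P]_v (c t v i ^+ 2) <= V i.
Variable g : nat -> R.
Hypothesis g_ge0 : forall t, 0 <= g t.
Hypothesis g_le1 : \forall t \near \oo, g t <= 1.
Hypothesis g_div : divergent_sum g.
Hypothesis c_g : {ae P, forall v, forall i, exists eps : nat -> R,
  limsup_le0 (fun t => `|eps t|) /\
  forall t, c t v i * p i = g t * (1 + eps t)}.
Hypothesis Jrec : forall t v i, J t.+1 v i 0 = J t v i 0 +
  chosen R sel t i v * c t v i *
    (policy_cost M (mu t v) i 0 - J t v i 0 + w t v i 0).
Hypothesis greedy : forall t v nu i,
  Tpol M (mu t v) (J t v) i 0 <= Tpol M nu (J t v) i 0.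
Variable mustar : policy n A.
Hypothesis mustar_opt :
  forall nu i, policy_cost M mustar i 0 <= policy_cost M nu i 0.

Let pastm t : past t `<=` measurable.
Proof. exact: past_measurable. Qed.

Let Jp k t i : (k <= t)%N -> gen_measurable (past t) (fun v => J k v i 0).
Proof. exact: J_past. Qed.

Let mup k t (h : policy n A -> R) : (k <= t)%N ->
  gen_measurable (past t) (fun v => h (mu k v)).
Proof. exact: mu_past. Qed.

Section Multiplier.
Variables (h : nat -> Omega -> R) (b : R) (i : 'I_n).
Hypothesis h_past : forall t, gen_measurable (past t) (h t).
Hypothesis h_bounded : forall t v, `|h t v| <= b.

Let a_past t : gen_measurable (past t) (fun v => h t v * c t v i).
Proof. exact: measurable_funM (@h_past t) (@c_past t i). Qed.

Let a_bounded t v : `|h t v * c t v i| <= b * Kc.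
Proof.
by rewrite normrM ler_pM // ger0_norm.
Qed.

Let a_sqr N : \sum_(0 <= t < N) \int[P]_v ((h t v * c t v i) ^+ 2) <= b ^+ 2 * V i.
Proof.
apply: (@le_trans _ _ (\sum_(0 <= t < N) (b ^+ 2 * \int[P]_v (c t v i ^+ 2)))).
  apply: ler_sum => t _.
  have mc2 : measurable_fun setT (fun v => c t v i ^+ 2).
    exact: measurable_funX (gen_measurable_measurable (@pastm t) (@c_past t i)).
  have ic2 : P.-integrable setT (fun v => (c t v i ^+ 2)%:E).
    apply: (@integrable_bounded _ _ _ P _ (Kc ^+ 2)) => // v.
    rewrite ger0_norm ?sqr_ge0 // lerXn2r ?nnegrE //.
    exact: le_trans (c_ge0 t v i) (c_le t v i).
  rewrite -RintegralZl //; apply: le_Rintegral => //.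
  - apply: (@integrable_bounded _ _ _ P _ ((b * Kc) ^+ 2)).
      apply: measurable_funX.
      exact: (gen_measurable_measurable (@pastm t) (@a_past t)).
    move=> v; rewrite normrX lerXn2r ?nnegrE //.
    by apply: le_trans (a_bounded t v).
  - exact: (@integrableZl _ _ _ P setT measurableT (b ^+ 2) _ ic2).
  move=> v _; rewrite exprMn ler_wpM2r ?sqr_ge0 //.
  rewrite -[leLHS]real_normK ?num_real // lerXn2r ?nnegrE //.
  exact: le_trans (h_bounded t v).
by rewrite -mulr_sumr ler_wpM2l ?sqr_ge0.
Qed.

Lemma scaled_selection_series :
  {ae P, forall v, cvgn (fun N => \sum_(0 <= t < N)
     (chosen R sel t i v - p i) * (h t v * c t v i))}.
Proof.
exact: (selection_series_cvg Jmeas wmeas mumeas selmeas hsel hindep i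
  (@a_past) a_bounded a_sqr).
Qed.

(** The product of the step, the selection and the noise is read off the
    increment of the iterates, which makes it known at time t + 1 even when the
    step vanishes. *)
Lemma scaled_noise_series :
  {ae P, forall v, cvgn (fun N => \sum_(0 <= t < N)
     chosen R sel t i v * w t v i 0 * (h t v * c t v i))}.
Proof.
apply: (noise_series_cvg Jmeas wmeas mumeas selmeas hsel hindep hw0 hw2
  (@a_past) a_bounded a_sqr).
move=> t.
have -> : (fun v => chosen R sel t i v * w t v i 0 * (h t v * c t v i)) =
    (fun v => h t v * (J t.+1 v i 0 - J t v i 0 - chosen R sel t i v * c t v i *
       (policy_cost M (mu t v) i 0 - J t v i 0))).
  by apply/funext => v; rewrite Jrec; ring.
have J0 := @Jp _ _ i (leqnSn t).
have J1 := @Jp _ _ i (leqnn t.+1).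
have up (f : Omega -> R) : gen_measurable (past t) f -> gen_measurable (past t.+1) f.
  by apply: gen_measurable_sub; exact: past_mono.
have h1 := @up _ (@h_past t).
have c1 := @up _ (@c_past t i).
have ch : gen_measurable (past t.+1) (chosen R sel t i) by exact: chosen_past.
have m1 := @mup _ _ (fun m => policy_cost M m i 0) (leqnSn t).
apply: measurable_funM => //; apply: measurable_funB.
  exact: measurable_funB.
by apply: measurable_funM; [exact: measurable_funM|exact: measurable_funB].
Qed.

End Multiplier.

Let B := \sum_(m : policy n A) \sum_i `|policy_cost M m i 0|.

Let leB m i : `|policy_cost M m i 0| <= B.
Proof.
rewrite /B (bigD1 m) //= (bigD1 i) //= -addrA lerDl addr_ge0 //.
  exact: sumr_ge0.
by apply: sumr_ge0 => m' _; exact: sumr_ge0.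
Qed.

(** The coefficients against which the noise is summed: 1 for the iterates
    themselves, and the entries of P_mu_t for the gap T J_t - J_t. *)
Let weight (q : option 'I_n) (j : 'I_n) t v : R :=
  if q is Some i then trans M i (mu t v i) j else 1.

Let weight_past q j t : gen_measurable (past t) (weight q j t).
Proof.
case: q => [i|]; last exact: measurable_cst.
exact: (@mup _ _ (fun m => trans M i (m i) j) (leqnn t)).
Qed.

Let weight_bounded q j t v : `|weight q j t v| <= 1.
Proof.
case: q => [i|] /=; last by rewrite normr1.
rewrite ger0_norm ?trans_ge0 //; apply: le_trans (trans_le1 M i (mu t v i)).
by rewrite (bigD1 j) //= lerDl; apply: sumr_ge0 => k _; exact: trans_ge0.
Qed.

(** The drift truncated where |J_t(j)| exceeds K, so that the selection noise has
    bounded coefficients. *)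
Let gap (K : nat) j t v : R :=
  (policy_cost M (mu t v) j 0 - J t v j 0) * (`|J t v j 0| <= K%:R)%R%:R.

Let gap_past K j t : gen_measurable (past t) (gap K j t).
Proof.
have J0 := @Jp _ _ j (leqnn t).
apply: measurable_funM.
  apply: measurable_funB => //.
  exact: (@mup _ _ (fun m => policy_cost M m j 0) (leqnn t)).
apply: measurable_natr_bool.
apply: measurable_fun_ler; last exact: measurable_cst.
exact: (measurableT_comp (@normr_measurable R setT)).
Qed.

Let gap_bounded K j t v : `|gap K j t v| <= B + K%:R.
Proof.
rewrite /gap; case: (leP `|J t v j 0| K%:R) => h; rewrite ?mulr1 ?mulr0 ?normr0.
  apply: le_trans (ler_normB _ _) _; exact: lerD.
by apply: addr_ge0 => //; do 2 apply: sumr_ge0 => ? _.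
Qed.

Let weighted_gap_bounded K q j t v :
  `|weight q j t v * gap K j t v| <= 1 * (B + K%:R).
Proof. by rewrite normrM ler_pM. Qed.

(** On almost every path the noise series converge for all truncation levels at
    once.  Convergence for the simulation noise already bounds the iterates;
    choosing a level above that bound removes the truncation, and the path falls under the
    deterministic theorem. *)
Theorem optimistic_iteration_cvg :
  {ae P, forall v, forall i,
    (fun t => J t v i 0) @ \oo --> policy_cost M mustar i 0}.
Proof.
have noise q j := @scaled_noise_series (weight q j) 1 j
  (@weight_past q j) (@weight_bounded q j).
have select K q j := @scaled_selection_series
  (fun t v => weight q j t v * gap K j t v) (1 * (B + K%:R)) j
  (fun t => measurable_funM (@weight_past q j t) (@gap_past K j t))
  (@weighted_gap_bounded K q j).
have noise' : {ae P, forall v, forall q j, cvgn (fun N => \sum_(0 <= t < N)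
     chosen R sel t j v * w t v j 0 * (weight q j t v * c t v j))}.
  by apply: filter_forall => q; apply: filter_forall => j; exact (noise q j).
have select' : {ae P, forall v, forall K q j, cvgn (fun N => \sum_(0 <= t < N)
     (chosen R sel t j v - p j) * (weight q j t v * gap K j t v * c t v j))}.
  apply/ae_foralln => K.
  by apply: filter_forall => q; apply: filter_forall => j; exact (select K q j).
apply: filterS3 c_g noise' select' => v cg nv sv.
have bounded j : exists K, forall t, `|J t v j 0| <= K.
  apply: (@averaging_bounded _ (fun t => chosen R sel t j v * c t v j)
    (fun t => policy_cost M (mu t v) j 0) _
    (fun t => chosen R sel t j v * w t v j 0 * (weight None j t v * c t v j)) B).
  - by move=> t; rewrite mulr_ge0 //; case/andP: (chosen01 R sel t j v).
  - near=> t; have /andP[c0 c1] := chosen01 R sel t j v.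
    have c2 : c t v j <= 1 by move: v j {cg nv sv c0 c1}; near: t.
    by rewrite mulr_ile1.
  - by move=> t; exact: leB.
  - exact: nv.
  - by move=> t; rewrite Jrec /=; ring.
have [K hK] := choice bounded.
(* One integer level above the bounds of all the states. *)
have [K' hK'] : exists K' : nat, forall j t, `|J t v j 0| <= K'%:R.
  exists (Num.bound (\sum_j `|K j|)) => j t.
  apply: le_trans (hK j t) _; apply: le_trans (ler_norm _) _.
  apply: (@le_trans _ _ (\sum_j `|K j|)).
    by rewrite (bigD1 j) //= lerDl; exact: sumr_ge0.
  apply/ltW; apply: archi_boundP; exact: sumr_ge0.
have gapE j t : gap K' j t v = policy_cost M (mu t v) j 0 - J t v j 0.
  by rewrite /gap hK' mulr1.
have [eps heps] := choice cg.
(* Simulation noise plus selection noise. *)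
pose zt t j := chosen R sel t j v * w t v j 0 * c t v j +
  (chosen R sel t j v - p j) *
    ((policy_cost M (mu t v) j 0 - J t v j 0) * c t v j).
have ztE q j : cvgn (fun N => \sum_(0 <= t < N) weight q j t v * zt t j).
  have -> : (fun N => \sum_(0 <= t < N) weight q j t v * zt t j) =
      (fun N => \sum_(0 <= t < N)
        chosen R sel t j v * w t v j 0 * (weight q j t v * c t v j)) \+
      (fun N => \sum_(0 <= t < N)
        (chosen R sel t j v - p j) * (weight q j t v * gap K' j t v * c t v j)).
    apply/funext => N /=; rewrite -big_split; apply: eq_bigr => t _ /=.
    rewrite gapE /zt; ring.
  apply: is_cvgD; [exact: nv|exact: sv].
have := @iterates_cvg R n A M mp (fun t => J t v) (fun t => mu t v) g
  (fun t j => eps j t * (policy_cost M (mu t v) j 0 - J t v j 0)) zt.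
apply => //.
- move=> i; have [e0 _] := heps i.
  apply: (@limsup_le0_le _ _ (fun t => (B + K'%:R) * `|eps i t|)).
    near=> t; rewrite normrM mulrC ler_wpM2r //.
    apply: le_trans (ler_normB _ _) _; exact: lerD.
  apply: limsup_le0_scale => //.
  by apply: addr_ge0 => //; do 2 apply: sumr_ge0 => ? _.
- move=> i; have := ztE None i.
  by under eq_fun do under eq_bigr do rewrite mul1r.
- by move=> i j; exact: ztE (Some i) j.
- move=> t i; rewrite Jrec /zt.
  have [_ /(_ t) e1] := heps i.
  have : c t v i * p i * (policy_cost M (mu t v) i 0 - J t v i 0) =
    g t * (1 + eps i t) * (policy_cost M (mu t v) i 0 - J t v i 0) by rewrite e1.
  lra.
Unshelve. all: by end_near. Qed.

End Core.

(** * Empirical selection frequencies *)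

Lemma Rintegral_probability_cst (R : realType) (d : measure_display)
  (Omega : measurableType d) (P : probability Omega R) (r : R) :
  \int[P]_v r = r.
Proof.
rewrite Rintegral_cst // -[RHS]mulr1; congr (_ * _).
exact: (congr1 fine (probability_setT P)).
Qed.

Section Frequencies.
Context (R : realType) (n : nat) (A : finType).
Context (d : measure_display) (Omega : measurableType d).
Variables (P : probability Omega R) (J w : nat -> Omega -> 'cV[R]_n).
Variables (mu : nat -> Omega -> policy n A) (sel : nat -> Omega -> 'I_n).
Variables (p : 'I_n -> R).
Hypothesis Jmeas : forall t i, measurable_fun setT (fun v => J t v i 0).
Hypothesis wmeas : forall t i, measurable_fun setT (fun v => w t v i 0).
Hypothesis mumeas : forall t m, measurable (mu t @^-1` [set m]).
Hypothesis selmeas : forall t i, measurable (sel t @^-1` [set i]).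
Hypothesis hp : forall i, 0 < p i.
Hypothesis hsel : forall t i, P (sel t @^-1` [set i]) = (p i)%:E.
Hypothesis hindep : forall t, independent_from P (sel t)
  (joined_with (natural_filtration J mu sel t) (w t)).

Definition count_before (t : nat) (i : 'I_n) (v : Omega) : R :=
  \sum_(0 <= k < t) chosen R sel k i v.

Lemma count_before_ge0 t i v : 0 <= count_before t i v.
Proof. by apply: sumr_ge0 => k _; case/andP: (chosen01 R sel k i v). Qed.

Lemma count_before_past t i : gen_measurable (past J mu sel t) (count_before t i).
Proof.
rewrite (_ : count_before t i = fun v => \sum_(k < t) chosen R sel k i v).
  by apply: measurable_sum => k; exact: chosen_past.
by apply/funext => v; rewrite /count_before big_mkord.
Qed.

(** When i is selected at time t, the number of selections including t is one
    more than the number of selections before t; written in this form, the step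
    is known at time t. *)
Definition empirical_step (t : nat) (v : Omega) (i : 'I_n) : R :=
  (1 + count_before t i v)^-1.

Lemma empirical_step_ge0 t v i : 0 <= empirical_step t v i.
Proof. by rewrite invr_ge0 addr_ge0 ?count_before_ge0. Qed.

Lemma empirical_step_le1 t v i : empirical_step t v i <= 1.
Proof.
rewrite invf_le1 ?lerDl ?count_before_ge0 //.
by apply: ltr_wpDr; rewrite ?count_before_ge0.
Qed.

Lemma empirical_step_past t i :
  gen_measurable (past J mu sel t) (fun v => empirical_step t v i).
Proof.
rewrite (_ : (fun v => _) = (@powR R ^~ (-1)) \o (fun v => 1 + count_before t i v)).
  apply: measurableT_comp; first exact: measurable_powR.
  apply: measurable_funD; [exact: measurable_cst|exact: count_before_past].
by apply/funext => v /=; rewrite powR_inv1 // addr_ge0 ?count_before_ge0.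
Qed.

(** The k-th selection of i contributes 1/k^2 <= 2/k - 2/(k + 1). *)
Lemma chosen_step_sqr_sum N i v :
  \sum_(0 <= t < N) chosen R sel t i v * empirical_step t v i ^+ 2 <=
  2 - 2 * empirical_step N v i.
Proof.
elim: N => [|N IH].
  rewrite big_geq // /empirical_step /count_before big_geq // addr0 invr1.
  by rewrite mulr1 subrr.
rewrite big_nat_recr //=; apply: le_trans (lerD IH (lexx _)) _.
rewrite /empirical_step {3}/count_before big_nat_recr //= -/(count_before _ _ _).
have := count_before_ge0 N i v; set x := count_before N i v => x0.
rewrite /chosen; case: (_ == _); last by rewrite mul0r !addr0.
have h1 : 0 < 1 + x by lra.
have h2 : 0 < 1 + (x + 1) by lra.
rewrite mul1r -subr_ge0.
have -> : 2 - 2 / (1 + (x + 1)) - (2 - 2 / (1 + x) + (1 + x)^-1 ^+ 2) =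
   x / ((1 + x) ^+ 2 * (1 + (x + 1))).
  by field; rewrite !gt_eqF.
by rewrite divr_ge0 // mulr_ge0 ?sqr_ge0 // ltW.
Qed.

(** The selection is independent of the step, so p(i) times the sum of the second
    moments is the expectation of the sum over the times at which i is selected. *)
Lemma empirical_step_sqr i N :
  \sum_(0 <= t < N) \int[P]_v (empirical_step t v i ^+ 2) <= 2 / p i.
Proof.
rewrite ler_pdivlMr // mulr_suml.
have mc t : measurable_fun setT (fun v => empirical_step t v i).
  exact: gen_measurable_measurable (@past_measurable _ _ _ _ _ _ _ _ Jmeas mumeas selmeas t)
    (@empirical_step_past t i).
have mc2 t : measurable_fun setT (fun v => empirical_step t v i ^+ 2).
  exact: measurable_funX.
have bc2 t v : `|empirical_step t v i ^+ 2| <= 1.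
  rewrite ger0_norm ?sqr_ge0 // expr_le1 ?empirical_step_le1 //.
  exact: empirical_step_ge0.
have ic2 t := integrable_bounded P (mc2 t) (bc2 t).
have mch t : measurable_fun setT (chosen R sel t i) by exact: measurable_chosen.
have bch t v : `|chosen R sel t i v| <= 1.
  by have /andP[c0 c1] := chosen01 R sel t i v; rewrite ger0_norm.
have ich t : P.-integrable setT
    (fun v => (chosen R sel t i v * empirical_step t v i ^+ 2)%:E).
  have := integrable_bounded_mul (ic2 t) (mch t) (bch t).
  by under eq_fun do rewrite mulrC.
have e t : \int[P]_v (empirical_step t v i ^+ 2) * p i =
    \int[P]_v (chosen R sel t i v * empirical_step t v i ^+ 2).
  have ip : P.-integrable setT (fun v => (p i * empirical_step t v i ^+ 2)%:E).
    exact: (@integrableZl _ _ _ P setT measurableT (p i) _ (ic2 t)).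
  rewrite mulrC -RintegralZl //; apply/esym/eqP; rewrite -subr_eq0.
  rewrite -RintegralB //; last exact: ich.
  under eq_Rintegral do rewrite -mulrBl.
  apply/eqP; apply: (selection_orthogonal Jmeas wmeas mumeas selmeas hsel hindep);
    last exact: ic2.
  apply: past_sub_past_noise; exact: measurable_funX (@empirical_step_past t i).
rewrite (eq_bigr _ (fun t _ => e t)).
have isum K : P.-integrable setT (EFin \o (fun v =>
    \sum_(0 <= t < K) chosen R sel t i v * empirical_step t v i ^+ 2)).
  rewrite (_ : _ \o _ = (fun v => \sum_(0 <= t < K)
        (chosen R sel t i v * empirical_step t v i ^+ 2)%:E)%E).
    by apply: integrable_sum => // t _; exact: ich.
  by apply/funext => v /=; rewrite sumEFin.
have -> : \sum_(0 <= t < N) \int[P]_v (chosen R sel t i v * empirical_step t v i ^+ 2) =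
    \int[P]_v (\sum_(0 <= t < N) chosen R sel t i v * empirical_step t v i ^+ 2).
  elim: N => [|N IH].
    rewrite big_geq //; under eq_Rintegral do rewrite big_geq //.
    by rewrite Rintegral_cst // mul0r.
  rewrite big_nat_recr //= IH -RintegralD //; last exact: ich.
  by apply: eq_Rintegral => v _; rewrite big_nat_recr.
apply: (@le_trans _ _ (\int[P]_v (cst 2 v))).
  apply: le_Rintegral => //.
  - exact: finite_measure_integrable_cst.
  move=> v _ /=; apply: le_trans (chosen_step_sqr_sum N i v) _.
  by rewrite gerBl mulr_ge0 // empirical_step_ge0.
by rewrite Rintegral_probability_cst.
Qed.

Lemma inv_sqr_sum N : \sum_(0 <= t < N) (t.+2%:R^-1 : R) ^+ 2 <= 1 - N.+1%:R^-1.
Proof.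
elim: N => [|N IH]; first by rewrite big_geq // invr1 subrr.
rewrite big_nat_recr //=; apply: le_trans (lerD IH (lexx _)) _.
have h1 : (0 : R) < N.+1%:R by [].
rewrite -(natr1 N.+1); set x : R := N.+1%:R in h1 *.
have h2 : 0 < x + 1 by lra.
rewrite -subr_ge0.
have -> : 1 - (x + 1)^-1 - (1 - x^-1 + (x + 1)^-1 ^+ 2) = (x * (x + 1) ^+ 2)^-1.
  by field; rewrite !gt_eqF.
by rewrite invr_ge0 mulr_ge0 ?sqr_ge0 // ltW.
Qed.

Lemma harmonic_divergent : divergent_sum (fun t => t.+1%:R^-1 : R).
Proof.
move=> K; apply: contrapT => nK; apply: (@dvg_harmonic R).
apply: nondecreasing_is_cvgn.
  by apply: nondecreasing_series => t _ _; rewrite /= invr_ge0.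
exists K => _ [N _ <-]; rewrite leNgt; apply/negP => h; apply: nK; exists N.
exact: ltW.
Qed.

Lemma shifted_harmonic_divergent : divergent_sum (fun t => t.+2%:R^-1 : R).
Proof.
move=> K; have [N hN] := harmonic_divergent (1 + K).
exists N; apply: (@le_trans _ _ (\sum_(0 <= t < N.+1) (t.+1%:R^-1 : R) - 1)).
  rewrite lerBrDl; apply: le_trans hN _.
  by rewrite big_nat_recr //= lerDl invr_ge0.
by rewrite big_nat_recl //= invr1 addrAC subrr add0r.
Qed.

(** The strong law of large numbers for the selections: the frequency, shifted
    to start at 1, is an average with steps 1/(t + 2), and the selection noise
    with these weights is summable. *)
Lemma frequency_cvg : {ae P, forall v, forall i,
  limsup_le0 (fun t => `|(1 + count_before t i v) / t.+1%:R - p i|)}.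
Proof.
have g0 t : 0 <= (t.+2%:R^-1 : R) by rewrite invr_ge0.
have g1 t : (t.+2%:R^-1 : R) <= 1 by rewrite invf_le1 // ler1n.
have sel_cvg i := selection_series_cvg Jmeas wmeas mumeas selmeas hsel hindep
  (a := fun t _ => t.+2%:R^-1) (b := 1) (V := 1) i
  (fun t => measurable_cst _) (fun t v => _) (fun N => _).
have sel_cvg' : {ae P, forall v, forall i, cvgn (fun N =>
    \sum_(0 <= t < N) (chosen R sel t i v - p i) * (t.+2%:R^-1 : R))}.
  apply: filter_forall => i; apply: sel_cvg.
  - by move=> t v; rewrite ger0_norm.
  - move=> N; apply: (@le_trans _ _ (\sum_(0 <= t < N) (t.+2%:R^-1 : R) ^+ 2)).
      apply: ler_sum => t _.
      by rewrite Rintegral_probability_cst.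
    apply: le_trans (inv_sqr_sum N) _; by rewrite gerBl invr_ge0.
apply: filterS sel_cvg' => v sc i.
pose x t : R := (1 + count_before t i v) / t.+1%:R - p i.
have xrec t : x t.+1 = (1 - t.+2%:R^-1) * x t + (chosen R sel t i v - p i) * t.+2%:R^-1.
  rewrite /x /count_before big_nat_recr //= -/(count_before t i v).
  rewrite -(natr1 t.+1); set y : R := t.+1%:R.
  have y0 : 0 < y by []; have y1 : 0 < y + 1 by lra.
  by field; rewrite !gt_eqF.
have up : limsup_le0 x.
  apply: (@averaging_limsup_le0 _ (fun t => t.+2%:R^-1) x (fun=> 0)
    (fun t => (chosen R sel t i v - p i) * t.+2%:R^-1)) => //.
  - by near=> t.
  - exact: shifted_harmonic_divergent.
  - by move=> e e0; near=> t; exact: ltW.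
  by near=> t; rewrite xrec mulr0 addr0.
have lo : limsup_le0 (fun t => - x t).
  apply: (@averaging_limsup_le0 _ (fun t => t.+2%:R^-1) _ (fun=> 0)
    (fun t => - ((chosen R sel t i v - p i) * t.+2%:R^-1))) => //.
  - by near=> t.
  - exact: shifted_harmonic_divergent.
  - by move=> e e0; near=> t; exact: ltW.
  - have -> : (fun N => \sum_(0 <= t < N) - ((chosen R sel t i v - p i) * (t.+2%:R^-1 : R))) =
      \- (fun N => \sum_(0 <= t < N) (chosen R sel t i v - p i) * (t.+2%:R^-1 : R)).
      by apply/funext => N /=; rewrite sumrN.
    exact: is_cvgN.
  by near=> t; rewrite xrec mulr0 addr0 mulrN opprD.
move=> e e0; near=> t; rewrite -/(x t) ler_norml lerNl; apply/andP; split.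
  by near: t; exact: lo.
by near: t; exact: up.
Unshelve. all: by end_near. Qed.

Lemma empirical_step_asymptotics : {ae P, forall v, forall i,
  exists eps : nat -> R, limsup_le0 (fun t => `|eps t|) /\
  forall t, empirical_step t v i * p i = t.+1%:R^-1 * (1 + eps t)}.
Proof.
apply: filterS frequency_cvg => v fr i.
pose x t : R := (1 + count_before t i v) / t.+1%:R - p i.
have pi := hp i.
have xp t : 0 < x t + p i.
  rewrite subrK divr_gt0 //.
  by apply: ltr_wpDr; rewrite ?count_before_ge0.
exists (fun t => p i / (x t + p i) - 1); split; last first.
  move=> t; rewrite addrC subrK /x subrK /empirical_step.
  have := count_before_ge0 t i v => c0.
  have c1 : 0 < 1 + count_before t i v by lra.
  have t0 : (0 : R) < t.+1%:R by [].
  by field; rewrite !gt_eqF.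
move=> e e0.
have p2 : 0 < p i / 2 by rewrite divr_gt0.
have ep2 : 0 < e * (p i / 2) by rewrite mulr_gt0.
near=> t.
have h1 : `|x t| <= p i / 2 by near: t; exact: fr.
have h2 : `|x t| <= e * (p i / 2) by near: t; exact: fr.
have -> : p i / (x t + p i) - 1 = - x t / (x t + p i).
  by field; rewrite gt_eqF.
rewrite normrM normrN normfV (ger0_norm (ltW (xp t))) ler_pdivrMr //.
apply: le_trans h2 _; rewrite ler_pM2l //.
move: h1; rewrite ler_norml => /andP[h1 _]; lra.
Unshelve. all: by end_near. Qed.

End Frequencies.

(** * The two choices of stepsizes *)

Lemma cvg_col (R : realType) (n : nat) (u : nat -> 'cV[R]_n) (l : 'cV[R]_n) :
  (forall i, (fun t => u t i 0) @ \oo --> l i 0) -> u @ \oo --> l.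
Proof.
move=> h; apply/cvg_ballP => e e0; near=> t; split=> // i j.
rewrite (ord1 j); move: i; near: t; apply: filter_forall => i.
exact: (cvg_ball (h i)).
Unshelve. all: by end_near. Qed.

Section DeterministicSteps.
Context (R : realType).
Variable ghat : nat -> R.
Hypothesis ghat_ge0 : forall t, 0 <= ghat t.

Lemma divergent_sum_ereal :
  (\sum_(0 <= t <oo) (ghat t)%:E = +oo)%E -> divergent_sum ghat.
Proof.
move=> h K; apply: contrapT => nK.
have : (\sum_(0 <= t <oo) (ghat t)%:E <= K%:E)%E.
  apply: lime_le; first by apply: is_cvg_nneseries => t _ _; rewrite lee_fin.
  apply: nearW => N; rewrite sumEFin lee_fin leNgt; apply/negP => hK.
  by apply: nK; exists N; exact: ltW.
by rewrite h leye_eq.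
Qed.

Lemma sqr_sum_bounded : (\sum_(0 <= t <oo) (ghat t ^+ 2)%:E < +oo)%E ->
  exists L, forall N, \sum_(0 <= t < N) ghat t ^+ 2 <= L.
Proof.
move=> h; have s0 t : (0 <= (ghat t ^+ 2)%:E)%E by rewrite lee_fin sqr_ge0.
exists (fine (\sum_(0 <= t <oo) (ghat t ^+ 2)%:E)%E) => N.
rewrite -lee_fin fineK ?ge0_fin_numE ?nneseries_ge0 // -sumEFin.
exact: nneseries_lim_ge.
Qed.

Lemma sqr_summable_vanishes L e : (forall N, \sum_(0 <= t < N) ghat t ^+ 2 <= L) ->
  0 < e -> \forall t \near \oo, ghat t <= e.
Proof.
move=> hL e0; have e2 : 0 < e ^+ 2 by rewrite exprn_gt0.
have [m hm] := bounded_series_tail (fun t => sqr_ge0 (ghat t)) hL e2.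
exists m => // t /= mt; have := hm (t - m).+1.
rewrite big_nat_recr //= subnKC // => h.
have : ghat t ^+ 2 <= e ^+ 2.
  by apply: le_trans h; rewrite lerDr; apply: sumr_ge0 => k _; exact: sqr_ge0.
by rewrite ler_pXn2r ?nnegrE // ltW.
Qed.

End DeterministicSteps.

Theorem proposition15
  (R : realType) (n : nat) (A : finType) (M : ssp R n A)
  (* the Markov chains defining the costs J^mu *)
  (d' : measure_display) (X : measurableType d')
  (Q : policy n A -> 'I_n -> probability X R)
  (s : nat -> X -> option 'I_n)
  (hs : forall mu i, is_trajectory M mu i (Q mu i) s)
  (hproper : forall mu, proper_policy Q s mu)
  (* the stochastic iteration *)
  (d : measure_display) (Omega : measurableType d) (P : probability Omega R)
  (J w : nat -> Omega -> 'cV[R]_n)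
  (mu : nat -> Omega -> policy n A)
  (sel : nat -> Omega -> 'I_n)
  (gamma : nat -> Omega -> 'I_n -> R)
  (p : 'I_n -> R) (C : R)
  (Jmeas : forall t i, measurable_fun setT (fun v => J t v i 0))
  (wmeas : forall t i, measurable_fun setT (fun v => w t v i 0))
  (mumeas : forall t m, measurable (mu t @^-1` [set m]))
  (selmeas : forall t i, measurable (sel t @^-1` [set i]))
  (hp : forall i, 0 < p i)
  (hsel : forall t i, P (sel t @^-1` [set i]) = (p i)%:E)
  (hindep : forall t,
     independent_from P (sel t)
       (joined_with (natural_filtration J mu sel t) (w t)))
  (hw0 : forall t i,
     is_cond_exp P (natural_filtration J mu sel t)
       (fun v => w t v i 0) (fun=> 0))
  (hw2 : forall t, exists2 Y : Omega -> R,
     is_cond_exp P (natural_filtration J mu sel t)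
       (fun v => sqnorm (w t v)) Y
     & {ae P, forall v, Y v <= C})
  (hgreedy : forall t v, Tpol M (mu t v) (J t v) = Topt M (J t v))
  (hJ : forall t v i,
     J t.+1 v i 0 =
     if sel t v == i then
       (1 - gamma t v i) * J t v i 0 +
       gamma t v i * (cost_to_go M Q s (mu t v) i 0 + w t v i 0)
     else J t v i 0) :
  ((forall t v i, gamma t v i = ((visits sel t v i)%:R)^-1) ->
   {ae P, forall v, J t v @[t --> \oo] --> optimal_cost M Q s})
  /\
  (forall ghat : nat -> R,
     (forall t, 0 <= ghat t) ->
     (\sum_(0 <= t <oo) (ghat t)%:E = +oo)%E ->
     (\sum_(0 <= t <oo) (ghat t ^+ 2)%:E < +oo)%E ->
     (forall t v i, gamma t v i = ghat t / p i) ->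
     {ae P, forall v, J t v @[t --> \oo] --> optimal_cost M Q s}).
Proof.
have mp m : max_principle (trans_mx M m).
  by move=> x hx i; exact: (subharmonic_le0 (hs m i) (hproper m i) hx).
have ctg m i : cost_to_go M Q s m i 0 = policy_cost M m i 0.
  rewrite mxE unlock.
  by rewrite (expected_total_cost (hs m i) (hproper m i) (mp m)).
have [mustar hstar] := optimal_policy mp (mu 0%N point).
have opt i : optimal_cost M Q s i 0 = policy_cost M mustar i 0.
  rewrite mxE.
  have [[m ->] le] := finmin_attained (fun m => cost_to_go M Q s m i 0) mustar.
  by apply/eqP; rewrite eq_le ctg hstar andbT -!ctg.
have greedy t v nu i : Tpol M (mu t v) (J t v) i 0 <= Tpol M nu (J t v) i 0.
  by rewrite hgreedy; exact: Topt_le_Tpol.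
have finish : {ae P, forall v, forall i,
      (fun t => J t v i 0) @ \oo --> policy_cost M mustar i 0} ->
    {ae P, forall v, J t v @[t --> \oo] --> optimal_cost M Q s}.
  apply: filterS => v h; apply: cvg_col => i; rewrite opt; exact: h.
split.
- move=> gE; apply: finish.
  apply: (@optimistic_iteration_cvg _ _ _ _ mp _ _ _ _ _ _ _ _ _ Jmeas wmeas
    mumeas selmeas hsel hindep hw0 hw2 (empirical_step R sel) 1
    (fun i => 2 / p i) _ _ _ _ _ (fun t => t.+1%:R^-1)) => //.
  + by move=> t i; exact: empirical_step_past.
  + by move=> t v i; exact: empirical_step_ge0.
  + by move=> t v i; exact: empirical_step_le1.
  + by near=> t => v i; exact: empirical_step_le1.
  + exact: (empirical_step_sqr Jmeas wmeas mumeas selmeas hp hsel hindep).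
  + by near=> t; rewrite invf_le1 // ler1n.
  + exact: harmonic_divergent.
  + exact: (empirical_step_asymptotics Jmeas wmeas mumeas selmeas hp hsel hindep).
  + move=> t v i; rewrite hJ gE ctg /chosen; case: eqP => [si|_]; last first.
      by rewrite mul0r mul0r addr0.
    have -> : (visits sel t v i)%:R = 1 + count_before R sel t i v.
      rewrite /visits natr_sum big_nat_recr //= si eqxx addrC; congr (_ + _).
    rewrite /empirical_step mul1r; ring.
- move=> ghat g0 gdiv gsq gE; apply: finish.
  have [L hL] := sqr_sum_bounded gsq.
  have pS i : (p i)^-1 <= \sum_j (p j)^-1.
    rewrite (bigD1 i) //= lerDl; apply: sumr_ge0 => j _; by rewrite invr_ge0 ltW.
  have L1 t : ghat t <= 1 + L.
    have h : ghat t ^+ 2 <= L.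
      apply: le_trans (hL t.+1); rewrite big_nat_recr //= lerDr.
      by apply: sumr_ge0 => k _; exact: sqr_ge0.
    have := sqr_ge0 (ghat t - 1); have := g0 t; nra.
  apply: (@optimistic_iteration_cvg _ _ _ _ mp _ _ _ _ _ _ _ _ _ Jmeas wmeas
    mumeas selmeas hsel hindep hw0 hw2 (fun t _ i => ghat t / p i)
    ((1 + L) * \sum_j (p j)^-1) (fun i => L / p i ^+ 2) _ _ _ _ _ ghat) => //.
  + by move=> t i; exact: measurable_cst.
  + by move=> t v i; rewrite divr_ge0 // ltW.
  + by move=> t v i; rewrite ler_pM // invr_ge0 ltW.
  + near=> t => v i; rewrite ler_pdivrMr // mul1r; move: i {v}; near: t.
    apply: filter_forall => i; exact: (sqr_summable_vanishes g0 hL (hp i)).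
  + move=> i N; under eq_bigr do rewrite Rintegral_probability_cst expr_div_n.
    by rewrite -mulr_suml ler_wpM2r // invr_ge0 sqr_ge0.
  + exact: (sqr_summable_vanishes g0 hL ltr01).
  + exact: divergent_sum_ereal.
  + apply: aeW => v i; exists (fun=> 0); split=> [e e0|t].
      by near=> t; rewrite normr0 ltW.
    by rewrite divfK ?gt_eqF // addr0 mulr1.
  + move=> t v i; rewrite hJ gE ctg /chosen; case: eqP => _; last first.
      by rewrite mul0r mul0r addr0.
    rewrite mul1r; ring.
Unshelve. all: by end_near. Qed.
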